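(* Let $(\Delta,\chi,E)$ be an arithmetic root system of rank $n$ and assume that $\{f_1,\dots,f_l\}\subset\Delta$, where $l<n$, is a linearly independent set over $\mathbb R$. Set $H:=\mathbb R f_1+\dots+\mathbb R f_l$ and $C:=\{\sum_{i=1}^l r_if_i\mid r_i\in\mathbb R,\ r_i\ge0\}$. Then $\Delta\cap H\subset C\cup -C$ if and only if for all $i<l$ and all $(m_{i+1},\dots,m_l)\in\mathbb N_0^{l-i}\setminus\{(0,\dots,0)\}$ one has $$f_i-\sum_{j=i+1}^l m_jf_j\notin\{N\beta\mid N\in\mathbb N,\ \beta\in\Delta\}.$$
   Context: $k$ is a field of characteristic $0$, $k^\ast=k\setminus\{0\}$, $\mathbb N=\{1,2,\dots\}$, $\mathbb N_0=\mathbb N\cup\{0\}$. A bicharacter on $\mathbb Z^n$ is a map $\chi:\mathbb Z^n\times\mathbb Z^n\to k^\ast$ with $\chi(0,a)=\chi(a,0)=1$, $\chi(a+b,c)=\chi(a,c)\chi(b,c)$, $\chi(a,b+c)=\chi(a,b)\chi(a,c)$. Let $F$ be a basis of $\mathbb Z^n$ and $f\in F$. For $f'\in F\setminus\{f\}$ put $$m(f,f')=\min\{m\in\mathbb N_0 \mid \chi(f,f)^m\chi(f,f')\chi(f',f)=1\ \text{or}\ (\chi(f,f)^{m+1}=1,\ \chi(f,f)\ne1)\}$$ if this minimum exists, and $m(f,f)=-2$. If all $m(f,f')$ exist, the reflection $s_{f,F}\in\mathrm{Aut}(\mathbb Z^n)$ is defined as the linear map with $s_{f,F}(f')=f'+m(f,f')f$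 for all $f'\in F$; otherwise $s_{f,F}$ is not defined. Let $\widetilde W$ be the groupoid of all pairs $(T,F)$, $T\in\mathrm{Aut}(\mathbb Z^n)$, $F$ a basis of $\mathbb Z^n$, where $(T_1,F_1)\circ(T_2,F_2)$ is defined, and equals $(T_1T_2,F_2)$, iff $T_2(F_2)=F_1$. For a basis $E$ of $\mathbb Z^n$, the Weyl groupoid $W_{\chi,E}$ is the smallest subgroupoid of $\widetilde W$ containing $(\mathrm{id},E)$ and such that if $(\mathrm{id},F)\in W_{\chi,E}$, $f\in F$ and $s_{f,F}$ is defined, then $(s_{f,F},F),(\mathrm{id},s_{f,F}(F))\in W_{\chi,E}$. It is full if $s_{f,F}$ is defined for all bases $F$ with $(\mathrm{id},F)\in W_{\chi,E}$ and all $f\in F$. An arithmetic root system (of rank $n$) is a triple $(\Delta,\chi,E)$ such that $W_{\chi,E}$ is full and finite and $\Delta=\bigcup\{F\mid(\mathrm{id},F)\in W_{\chi,E}\}$. *)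

(* Defs.v *)
From HB Require Import structures.
From mathcomp Require Import all_boot all_order all_algebra finmap.
From mathcomp Require Import boolp classical_sets functions cardinality reals.

Set Implicit Arguments.
Unset Strict Implicit.
Unset Printing Implicit Defensive.

Import Order.TTheory GRing.Theory Num.Theory.
Local Open Scope classical_set_scope.
Local Open Scope ring_scope.

(* The lattice Z^n is 'cV[int]_n, and Aut(Z^n) is the set of invertible integer
   matrices, acting by T *m v; composition T1 T2 is then T1 *m T2. *)

Section WeylGroupoid.

Variables (k : fieldType) (n : nat).

Implicit Types (chi : 'cV[int]_n -> 'cV[int]_n -> k).
Implicit Types (F E : {fset 'cV[int]_n}) (T : 'M[int]_n).

Record bicharacter chi : Prop := Bicharacter {
  bichar_neq0 : forall a b, chi a b != 0;
  bichar0l : forall a, chi 0 a = 1;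
  bichar0r : forall a, chi a 0 = 1;
  bicharDl : forall a b c, chi (a + b) c = chi a c * chi b c;
  bicharDr : forall a b c, chi a (b + c) = chi a b * chi a c
}.

(* Bases are unordered. *)
Definition is_basis F : Prop :=
  forall v : 'cV[int]_n,
    exists! c : {ffun F -> int}, v = \sum_(f : F) c f *: val f.

Definition im T F : {fset 'cV[int]_n} := [fset T *m v | v in F]%fset.

Definition m_cond chi (f f' : 'cV[int]_n) (m : nat) : bool :=
  (chi f f ^+ m * chi f f' * chi f' f == 1)
  || (chi f f ^+ m.+1 == 1) && (chi f f != 1).

(* None when the minimum does not exist. *)
Definition m_entry chi (f f' : 'cV[int]_n) : option int :=
  if f' == f then Some (- 2%:Z) else
  match pselect (exists m, m_cond chi f f' m) with
  | left ex_m => Some (ex_minn ex_m)%:Z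
  | right _ => None
  end.

(* The graph of the partial map (F, f) |-> s_{f,F}: for F a basis and f in F,
   at most one T satisfies this, and one does iff every m(f, f') exists. *)
Definition is_reflection chi F (f : 'cV[int]_n) T : Prop :=
  {in F, forall f', exists2 m : int,
    m_entry chi f f' = Some m & T *m f' = f' + m *: f}.

Definition reflection_defined chi F (f : 'cV[int]_n) : Prop :=
  exists T, is_reflection chi F f T.

(* The arrow (T, F) goes from F to T(F). *)
Definition Wtilde : set ('M[int]_n * {fset 'cV[int]_n}) :=
  [set p | p.1 \in unitmx /\ is_basis p.2].

Record subgroupoid (W : set ('M[int]_n * {fset 'cV[int]_n})) : Prop :=
  Subgroupoid {
    subgroupoid_sub : W `<=` Wtilde;
    subgroupoid_comp : forall T1 F1 T2 F2,
      W (T1, F1) -> W (T2, F2) -> im T2 F2 = F1 -> W (T1 *m T2, F2);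
    subgroupoid_inv : forall T F, W (T, F) -> W (invmx T, im T F)
  }.

Definition reflection_closed chi
    (W : set ('M[int]_n * {fset 'cV[int]_n})) : Prop :=
  forall F f T, W (1%:M, F) -> f \in F -> is_reflection chi F f T ->
    W (T, F) /\ W (1%:M, im T F).

Definition weyl_groupoid chi E : set ('M[int]_n * {fset 'cV[int]_n}) :=
  smallest [set W | subgroupoid W /\ reflection_closed chi W] [set (1%:M, E)].

Definition weyl_full chi E : Prop :=
  forall F f, weyl_groupoid chi E (1%:M, F) -> f \in F ->
    reflection_defined chi F f.

Record arithmetic_root_system (Delta : set 'cV[int]_n) chi E : Prop :=
  ArithmeticRootSystem {
    ars_bichar : bicharacter chi;
    ars_basis : is_basis E;
    ars_full : weyl_full chi E;
    ars_finite : finite_set (weyl_groupoid chi E);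
    ars_roots : Delta =
      \bigcup_(F in [set F | weyl_groupoid chi E (1%:M, F)]) [set` F]
  }.

End WeylGroupoid.

Definition to_real (R : realType) (n : nat) (v : 'cV[int]_n) : 'cV[R]_n :=
  map_mx intr v.

Definition real_family (R : realType) (n l : nat) (f : 'I_l -> 'cV[int]_n) :
  l.-tuple 'cV[R]_n := [tuple to_real R (f i) | i < l].

Definition real_span (R : realType) (n l : nat) (f : 'I_l -> 'cV[int]_n) :
  set 'cV[R]_n := [set` <<real_family R f>>%VS].

Definition real_cone (R : realType) (n l : nat) (f : 'I_l -> 'cV[int]_n) :
  set 'cV[R]_n :=
  [set v | exists r : 'I_l -> R,
     (forall i, 0 <= r i) /\ v = \sum_(i < l) r i *: to_real R (f i)].

Definition pos_multiples (n : nat) (Delta : set 'cV[int]_n) :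
  set 'cV[int]_n :=
  [set v | exists (N : nat) (beta : 'cV[int]_n),
     [/\ (0 < N)%N, Delta beta & v = beta *+ N]].

Arguments real_span R {n l} f.
Arguments real_cone R {n l} f.

(* Main.v *)
Require Import Defs.
From HB Require Import structures.
From mathcomp Require Import all_boot all_order all_algebra finmap.
From mathcomp Require Import boolp classical_sets functions cardinality reals.
From mathcomp Require Import fsbigop.
From mathcomp Require Import ring zify.

(** One implication compares coordinates: if [f_i - sum m_j f_j] is a positive
    multiple of a root, that root lies in [H] and has coordinates of both signs
    in the independent family [f].

    The converse rests on two facts about the bases [F] that occur in the Weyl
    groupoid.  Positivity ([root_sign]): in each of them every root has all its
    coordinates of one sign.  Chambers ([chamber_exists]): for every choice of
    one root in each pair [b], [- b], some [F] consists of chosen roots; an [F]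
    with the fewest wrong choices among its positive roots works, because the
    reflection at a wrong [f] in [F] only exchanges [f] and [- f].

    Complete [f] to a basis of the real space in which [f] comes last, order the
    vectors lexicographically by their coordinates, and take [F] lexicographically
    positive.  Leading coordinates of positive vectors cannot cancel, so a root in
    the span of [f_t, ..., f_(l-1)] is a combination of those elements of [F] that
    lie in this span ([support_vanish]).  Descending induction on [t] shows that
    these elements are [f_t, ..., f_(l-1)] themselves: the step from [t + 1] to
    [t] raises the dimension by one, hence adds one element [x] at most, and
    [f_t = a x + sum b_j f_j] with natural numbers [a > 0] and [b_j]; the
    hypothesis on [f_t - sum b_j f_j = a x] gives [b = 0], and [a = 1] because
    roots are primitive ([simple_step]).

    Positivity comes from Nichols algebras.  The bicharacter and a base [F] define
    a diagonal braiding and its Nichols algebra, graded by the lattice; it is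
    realised here in the space of functions on words, as the span of the images
    of [vacuum], the indicator of the empty word, under products of the operators
    [lmul].  Fix a letter [p].  The kernel of a skew derivation along [p] is a
    subalgebra [K], and the Nichols algebra is [K] tensored with the truncated
    polynomials in [x_p] ([nichols_dim_factor]).  When [F] is reflected at [p], the graded dimensions
    of [K] stay the same as a function on the lattice ([kernel_dim_reflect_eq]),
    and [1 + t^p + t^(2p) + ...] becomes [1 + t^(-p) + t^(-2p) + ...], with the
    same number of terms.  So let [P_F] be the logarithmic derivative, along a
    linear form [phi], of the Hilbert series of [F].  Then [P_F a - P_F (- a)] is
    the same for all [F] ([log_reflect]).  As [P_F] lives on the cone of [F] and
    does not vanish at [b] in [F] when [phi b <> 0], such a [b] lies in the cone
    of every other base or in its opposite. *)

Set Implicit Arguments.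
Unset Strict Implicit.
Unset Printing Implicit Defensive.

Import Order.TTheory GRing.Theory Num.Theory.
Local Open Scope classical_set_scope.
Local Open Scope ring_scope.

(** * Quantum integers *)

Lemma additive0 (G : zmodType) (c : G -> int) :
  (forall u v, c (u + v) = c u + c v) -> c 0 = 0.
Proof. by move=> cD; apply: (addrI (c 0)); rewrite -cD !addr0. Qed.

Section QuantumInteger.

Variable k : fieldType.

Definition qint (q : k) (a : nat) : k := \sum_(b < a) q ^+ b.

Lemma qint0 q : qint q 0 = 0.
Proof. by rewrite /qint big_ord0. Qed.

Lemma qintS q a : qint q a.+1 = qint q a + q ^+ a.
Proof. by rewrite /qint big_ord_recr. Qed.

Lemma qintSl q a : qint q a.+1 = 1 + q * qint q a.
Proof.
rewrite /qint big_ord_recl expr0; congr (_ + _).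
by rewrite big_distrr; apply: eq_bigr => i _; rewrite lift0 exprS.
Qed.

(** The powers of the degree-one element [x] with [chi(x,x) = q] that survive in
    the Nichols algebra are those with [qnonzero] exponent ([pw_eq0]); the order
    of [q] may be infinite, so a predicate replaces the truncation degree. *)
Definition qnonzero (q : k) (a : nat) : Prop :=
  forall b, (0 < b <= a)%N -> qint q b != 0.

End QuantumInteger.

(** * Functions on words and their operators *)

Section Words.

Variables (k : fieldType) (n : nat) (I : finType).
Notation G := ('cV[int]_n).
Variable chi : G -> G -> k.
Hypothesis chiP : bicharacter chi.
Variable deg : I -> G.

Notation A := (seq I -> k^o).

Lemma bicharNl a b : chi (- a) b = (chi a b)^-1.
Proof.
apply: (mulIf (bichar_neq0 chiP a b)).
rewrite -(bicharDl chiP) addNr (bichar0l chiP) mulVf //.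
exact: bichar_neq0.
Qed.

Lemma bicharNr a b : chi a (- b) = (chi a b)^-1.
Proof.
apply: (mulIf (bichar_neq0 chiP a b)).
rewrite -(bicharDr chiP) addNr (bichar0r chiP) mulVf //.
exact: bichar_neq0.
Qed.

Lemma bicharMnr a b m : chi a (b *+ m) = chi a b ^+ m.
Proof.
elim: m => [|m IH]; first by rewrite mulr0n (bichar0r chiP).
by rewrite mulrS (bicharDr chiP) IH exprS.
Qed.

Lemma bicharMnl a b m : chi (a *+ m) b = chi a b ^+ m.
Proof.
elim: m => [|m IH]; first by rewrite mulr0n (bichar0l chiP).
by rewrite mulrS (bicharDl chiP) IH exprS.
Qed.

Definition wdeg (w : seq I) : G := \sum_(i <- w) deg i.

Lemma wdeg_nil : wdeg [::] = 0.
Proof. by rewrite /wdeg big_nil. Qed.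

Lemma wdeg_cons i w : wdeg (i :: w) = deg i + wdeg w.
Proof. by rewrite /wdeg big_cons. Qed.

Lemma wdeg_rcons w i : wdeg (rcons w i) = wdeg w + deg i.
Proof. by rewrite /wdeg big_rcons. Qed.

Lemma wdeg_cat v w : wdeg (v ++ w) = wdeg v + wdeg w.
Proof. by rewrite /wdeg big_cat. Qed.

Lemma addfE (g h : A) v : (g + h) v = g v + h v :> k. Proof. by []. Qed.
Lemma oppfE (g : A) v : (- g) v = - g v :> k. Proof. by []. Qed.
Lemma zerofE v : (0 : A) v = 0 :> k. Proof. by []. Qed.
Lemma scalefE (x : k) (g : A) v : (x *: g) v = x * g v :> k. Proof. by []. Qed.
Definition ptE := (addfE, oppfE, zerofE, scalefE).

Definition vacuum : A := fun w => (w == [::])%:R.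
Notation vac := vacuum.

(** Words index products of skew derivations, and an element [u] of the tensor
    algebra becomes the function sending a word to the constant term of the
    corresponding derivative of [u].  The radical of the tensor algebra is exactly
    what this kills, so relations of the Nichols algebra become equations between
    functions.  In this picture [lder] and [rder] are the two skew derivations,
    [lmul] is left multiplication by a letter (a quantum shuffle), and [grad]
    evaluates the bicharacter on the degree. *)
Fixpoint lmulf (i : I) (g : A) (w : seq I) : k :=
  if w is j :: v then
    lmulf i (fun u => g (j :: u)) v + (i == j)%:R * chi (deg j) (wdeg v) * g v
  else 0.
Definition lmul (i : I) (g : A) : A := lmulf i g.
Definition lder (j : I) (g : A) : A := fun w => g (j :: w).
Definition rder (p : I) (g : A) : A := fun w => g (rcons w p).
Definition grad (c : G) (g : A) : A := fun w => chi c (wdeg w) * g w.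

Lemma lmul_linear i : linear (lmul i).
Proof.
move=> c g h; apply/funext => w.
elim: w g h => [|j v IH] g h; first by rewrite !ptE /lmul /=; ring.
rewrite /lmul /=.
have := IH (lder j g) (lder j h); rewrite /lmul /lder /=.
have -> : (c *: (fun w : seq I => g (j :: w)) + (fun w => h (j :: w)) : A)
        = (fun u : seq I => (c *: g + h : A) (j :: u)) by [].
by move=> ->; rewrite !ptE /=; ring.
Qed.
HB.instance Definition _ i :=
  GRing.isLinear.Build k A A *:%R (lmul i) (@lmul_linear i).

Lemma lder_linear i : linear (lder i).
Proof. by []. Qed.
HB.instance Definition _ i :=
  GRing.isLinear.Build k A A *:%R (lder i) (@lder_linear i).

Lemma rder_linear i : linear (rder i).
Proof. by []. Qed.
HB.instance Definition _ i :=
  GRing.isLinear.Build k A A *:%R (rder i) (@rder_linear i).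

Lemma grad_linear c : linear (grad c).
Proof. by move=> x g h; apply/funext => w; rewrite !ptE /grad !ptE; ring. Qed.
HB.instance Definition _ c :=
  GRing.isLinear.Build k A A *:%R (grad c) (@grad_linear c).

Lemma lmulD i g h : lmul i (g + h) = lmul i g + lmul i h.
Proof. exact: linearD. Qed.

Lemma lmulZ i c g : lmul i (c *: g) = c *: lmul i g.
Proof. exact: linearZ_LR. Qed.

Lemma lmul_nil i g : lmul i g [::] = 0.
Proof. by []. Qed.

Lemma lder_lmul j i g :
  lder j (lmul i g) = lmul i (lder j g) + (i == j)%:R *: grad (deg j) g.
Proof. by apply/funext => w; rewrite !ptE /lder /lmul /grad /= mulrA. Qed.

Lemma lder_rder j p g : lder j (rder p g) = rder p (lder j g).
Proof. by []. Qed.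

(** Unlike [lder_lmul], the twist sits on the letter that is jumped over: the
    two derivations are those of a braiding and of its inverse. *)
Lemma rder_lmul p i g :
  rder p (lmul i g) =
    chi (deg i) (deg p) *: lmul i (rder p g) + (i == p)%:R *: g.
Proof.
apply/funext => w; rewrite !ptE.
elim: w g => [|j v IH] g.
  rewrite /rder /lmul /= wdeg_nil (bichar0r chiP).
  ring.
have := IH (lder j g); rewrite /rder /lmul /lder /= => ->.
rewrite wdeg_rcons (bicharDr chiP).
by case: (eqVneq i j) => [->|_] /=; ring.
Qed.

Lemma grad_lmul c i g : grad c (lmul i g) = chi c (deg i) *: lmul i (grad c g).
Proof.
apply/funext => w; rewrite !ptE.
elim: w g => [|j v IH] g; first by rewrite /grad /lmul /=; ring.
rewrite /grad /lmul /= wdeg_cons (bicharDr chiP).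
rewrite mulrDr.
have := IH (lder j g); rewrite /grad /lmul /lder /= => E.
pose h : A := fun u => chi c (wdeg u) * g (j :: u).
have -> : (fun u : seq I => chi c (wdeg (j :: u)) * g (j :: u)) =
    (chi c (deg j) *: h : A).
  by apply/funext => u; rewrite !ptE wdeg_cons (bicharDr chiP) mulrA.
have -> : lmulf i (chi c (deg j) *: h : A) v = chi c (deg j) * lmulf i h v.
  have := linearZ_LR (lmul i : {linear A -> A}) (chi c (deg j)) h.
  by move=> /(congr1 (fun f : A => f v)).
rewrite -mulrDr -mulrA [X in _ * X = _]mulrDr E -/h.
by case: (eqVneq i j) => [<-|_] /=; ring.
Qed.

Lemma lder_grad c j g :
  lder j (grad c g) = chi c (deg j) *: grad c (lder j g).
Proof.
by apply/funext => w; rewrite !ptE /lder /grad wdeg_cons (bicharDr chiP) mulrA.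
Qed.

Lemma rder_grad c j g :
  rder j (grad c g) = chi c (deg j) *: grad c (rder j g).
Proof.
apply/funext => w; rewrite !ptE /rder /grad wdeg_rcons (bicharDr chiP).
ring.
Qed.

Lemma grad_vac c : grad c vac = vac.
Proof.
apply/funext => -[|i w]; rewrite /grad /vacuum /= ?mulr0 //.
by rewrite wdeg_nil (bichar0r chiP) mul1r.
Qed.

Lemma lder_vac j : lder j vac = 0.
Proof. by []. Qed.

Lemma rder_vac j : rder j vac = 0.
Proof. by apply/funext => -[|i w]. Qed.

Lemma grad_surj c g : grad c (grad (- c) g) = g.
Proof.
apply/funext => w; rewrite /grad bicharNl mulrA divff ?mul1r //.
exact: bichar_neq0.
Qed.

End Words.
Arguments vacuum k I : clear implicits.

(** * Noncommutative polynomials in operators *)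

Section FormalSums.

Variables (k : fieldType) (I : finType).
Notation A := (seq I -> k^o).
Notation fsum := (seq (k * seq I)).

Fixpoint word_op (O : I -> {linear A -> A}) (w : seq I) : {linear A -> A} :=
  if w is i :: v then O i \o word_op O v else idfun.

Definition ev (O : I -> {linear A -> A}) (P : fsum) (g : A) : A :=
  \sum_(t <- P) t.1 *: word_op O t.2 g.

Definition fscale (c : k) (P : fsum) : fsum := [seq (c * t.1, t.2) | t <- P].
Definition fpre (i : I) (P : fsum) : fsum := [seq (t.1, i :: t.2) | t <- P].
Definition fpost (i : I) (P : fsum) : fsum := [seq (t.1, rcons t.2 i) | t <- P].
Definition fmul (P R : fsum) : fsum :=
  [seq (a.1 * b.1, a.2 ++ b.2) | a <- P, b <- R].

Variable O : I -> {linear A -> A}.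

Lemma word_op_cat v w g : word_op O (v ++ w) g = word_op O v (word_op O w g).
Proof. by elim: v => //= i v ->. Qed.

Lemma word_op_rcons w i g : word_op O (rcons w i) g = word_op O w (O i g).
Proof. by rewrite -cats1 word_op_cat. Qed.

Lemma ev_linear P : linear (ev O P).
Proof.
move=> c g h; rewrite /ev scaler_sumr -big_split /=; apply: eq_bigr => t _.
by rewrite linearP scalerDr !scalerA mulrC.
Qed.
HB.instance Definition _ P :=
  GRing.isLinear.Build k A A *:%R (ev O P) (@ev_linear P).

Lemma evD P g h : ev O P (g + h) = ev O P g + ev O P h.
Proof. exact: linearD. Qed.

Lemma evB P g h : ev O P (g - h) = ev O P g - ev O P h.
Proof. exact: linearB. Qed.

Lemma evZ P c g : ev O P (c *: g) = c *: ev O P g.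
Proof. exact: linearZ_LR. Qed.

Lemma ev0 P : ev O P 0 = 0.
Proof. exact: linear0. Qed.

Lemma ev_nil g : ev O [::] g = 0.
Proof. by rewrite /ev big_nil. Qed.

Lemma ev_cons t P g : ev O (t :: P) g = t.1 *: word_op O t.2 g + ev O P g.
Proof. by rewrite /ev big_cons. Qed.

Lemma ev_cat P R g : ev O (P ++ R) g = ev O P g + ev O R g.
Proof. by rewrite /ev big_cat. Qed.

Lemma ev_scale c P g : ev O (fscale c P) g = c *: ev O P g.
Proof.
rewrite /ev big_map scaler_sumr; apply: eq_bigr => t _.
by rewrite scalerA.
Qed.

Lemma ev_pre i P g : ev O (fpre i P) g = O i (ev O P g).
Proof.
rewrite /ev big_map linear_sum; apply: eq_bigr => t _ /=.
by rewrite linearZ.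
Qed.

Lemma ev_post i P g : ev O (fpost i P) g = ev O P (O i g).
Proof.
by rewrite /ev big_map; apply: eq_bigr => t _ /=; rewrite word_op_rcons.
Qed.

Lemma ev_mul P R g : ev O (fmul P R) g = ev O P (ev O R g).
Proof.
rewrite /ev /fmul big_allpairs_dep /=; apply: eq_bigr => t _.
rewrite linear_sum scaler_sumr; apply: eq_bigr => s _ /=.
by rewrite word_op_cat linearZ scalerA.
Qed.

Lemma ev_flatten (J : Type) (r : seq J) (F : J -> fsum) g :
  ev O (flatten [seq F j | j <- r]) g = \sum_(j <- r) ev O (F j) g.
Proof.
elim: r => [|j r IH] /=; first by rewrite big_nil ev_nil.
by rewrite ev_cat big_cons IH.
Qed.

End FormalSums.

(** * The quantum Leibniz rule *)

Section Leibniz.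

Variables (k : fieldType) (n : nat) (I : finType).
Notation G := ('cV[int]_n).
Notation A := (seq I -> k^o).
Notation fsum := (seq (k * seq I)).
Variable chi : G -> G -> k.
Hypothesis chiP : bicharacter chi.
Variable deg : I -> G.

Definition homog (D : G) (P : fsum) : bool :=
  all (fun t => wdeg deg t.2 == D) P.

(** The skew derivation [lder] on the level of words: each occurrence of [j] is
    removed, at the cost of the bicharacter against what follows it. *)
Fixpoint wder (j : I) (w : seq I) : fsum :=
  if w is i :: v then
    (if i == j then [:: (chi (deg j) (wdeg deg v), v)] else [::])
      ++ fpre i (wder j v)
  else [::].

Definition fder (j : I) (P : fsum) : fsum :=
  flatten [seq fscale t.1 (wder j t.2) | t <- P].

Lemma homog_cat D P R : homog D (P ++ R) = homog D P && homog D R.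
Proof. exact: all_cat. Qed.

Lemma homog_scale D c P : homog D (fscale c P) = homog D P.
Proof. by rewrite /homog all_map. Qed.

Lemma homog_pre D i P : homog D P -> homog (deg i + D) (fpre i P).
Proof.
move=> h; rewrite /homog all_map; apply: sub_all h => t /= /eqP <-.
by rewrite wdeg_cons.
Qed.

Lemma homog_post D i P : homog D P -> homog (D + deg i) (fpost i P).
Proof.
move=> h; rewrite /homog all_map; apply: sub_all h => t /= /eqP <-.
by rewrite wdeg_rcons.
Qed.

Lemma homog_mul D D' P R :
  homog D P -> homog D' R -> homog (D + D') (fmul P R).
Proof.
move=> hP hR; apply/allP => t /allpairsP[[a b] /= [aP bR ->]] /=.
by rewrite wdeg_cat (eqP (allP hP _ aP)) (eqP (allP hR _ bR)).
Qed.

Lemma homog_wder j w : homog (wdeg deg w - deg j) (wder j w).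
Proof.
elim: w => //= i v IH; rewrite homog_cat; apply/andP; split.
  case: eqVneq => // ->.
  by rewrite /homog /= wdeg_cons addrC addKr eqxx.
by rewrite wdeg_cons -addrA homog_pre.
Qed.

Lemma homog_fder D j P : homog D P -> homog (D - deg j) (fder j P).
Proof.
elim: P => // t P IH /= /andP[/eqP tD hP].
have -> : fder j (t :: P) = fscale t.1 (wder j t.2) ++ fder j P by [].
by rewrite homog_cat homog_scale IH // andbT -tD homog_wder.
Qed.

Lemma ev_der (O : I -> {linear A -> A}) j P g :
  ev O (fder j P) g = \sum_(t <- P) t.1 *: ev O (wder j t.2) g.
Proof. by rewrite ev_flatten; apply: eq_bigr => t _; rewrite ev_scale. Qed.

(** [Q] is an operator that commutes with the generators [O i] up to scalars,
    except that meeting [O j] produces the grading operator [Th].  The scalars are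
    arranged so that the extra terms are those of [wder]; the free character [s]
    is what lets [Q] be either a derivation or a multiplication operator. *)
Section General.

Variables (O : I -> {linear A -> A}) (j : I) (Q Th : {linear A -> A}).
Variables (s : G -> k) (mu : k).
Hypothesis s0 : s 0 = 1.
Hypothesis sD : forall a b, s (a + b) = s a * s b.
Hypothesis QO : forall i g,
  Q (O i g) = s (deg i) *: (O i (Q g) + ((i == j)%:R * mu) *: Th g).
Hypothesis ThO : forall i g,
  Th (O i g) = (s (deg i) * chi (deg j) (deg i)) *: O i (Th g).

Lemma leibniz_grade w g :
  Th (word_op O w g) =
    (s (wdeg deg w) * chi (deg j) (wdeg deg w)) *: word_op O w (Th g).
Proof.
elim: w g => [|i w IH] g /=.
  by rewrite wdeg_nil s0 (bichar0r chiP) mulr1 scale1r.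
rewrite ThO IH linearZ /= scalerA wdeg_cons sD (bicharDr chiP).
by congr (_ *: _); ring.
Qed.

Lemma leibniz_word w g :
  Q (word_op O w g) =
    s (wdeg deg w) *: (word_op O w (Q g) + mu *: ev O (wder j w) (Th g)).
Proof.
elim: w g => [|i w IH] g /=.
  by rewrite wdeg_nil s0 ev_nil scaler0 addr0 scale1r.
have OD c u v : O i (u + c *: v) = O i u + c *: O i v.
  by rewrite addrC linearP addrC.
rewrite QO IH leibniz_grade ev_cat ev_pre linearZ_LR OD /=.
rewrite wdeg_cons sD; case: eqVneq => [->|_] /=; rewrite ?ev_cons !ev_nil /=.
  by apply/funext => v; rewrite !ptE; ring.
by apply/funext => v; rewrite !ptE; ring.
Qed.

Lemma leibniz D P g : homog D P ->
  Q (ev O P g) = s D *: (ev O P (Q g) + mu *: ev O (fder j P) (Th g)).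
Proof.
move=> hP; rewrite ev_der /ev linear_sum scaler_sumr -big_split scaler_sumr.
rewrite big_seq [RHS]big_seq; apply: eq_bigr => t tP /=.
rewrite linearZ /= leibniz_word (eqP (allP hP _ tP)) !scalerDr !scalerA.
by congr (_ *: _ + _ *: _); ring.
Qed.

End General.

End Leibniz.

(** * Relations between operators *)

Section Kernel.

Variables (k : fieldType) (n : nat) (I : finType).
Notation G := ('cV[int]_n).
Notation A := (seq I -> k^o).
Variable chi : G -> G -> k.
Hypothesis chiP : bicharacter chi.
Variable deg : I -> G.
Notation X := (lmul chi deg).

Lemma word_op_lmul_nil w g : word_op X w g [::] = (w == [::])%:R * g [::].
Proof. by case: w => [|i w] /=; rewrite ?mul1r ?mul0r. Qed.

Lemma lder_ev D P j g : homog deg D P ->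
  lder j (ev X P g) =
    ev X P (lder j g) + ev X (fder chi deg j P) (grad chi deg (deg j) g).
Proof.
move=> hP.
have := @leibniz _ _ _ _ chiP deg X j (lder j) (grad chi deg (deg j)) (fun=> 1)
  1 erefl _ _ _ D P g hP.
rewrite !scale1r; apply.
- by move=> a b; rewrite mulr1.
- by move=> i h; rewrite /= lder_lmul mulr1 scale1r.
- by move=> i h; rewrite /= grad_lmul // mul1r.
Qed.

Lemma grad_ev D P c g : homog deg D P ->
  grad chi deg c (ev X P g) = chi c D *: ev X P (grad chi deg c g).
Proof.
move=> hP; rewrite /ev linear_sum scaler_sumr big_seq [RHS]big_seq.
apply: eq_bigr => t tP; rewrite linearZ_LR /=.
have -> : grad chi deg c (word_op X t.2 g)
    = chi c (wdeg deg t.2) *: word_op X t.2 (grad chi deg c g).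
  elim: (t.2) => [|i w IH] /=.
    by rewrite wdeg_nil (bichar0r chiP) scale1r.
  by rewrite grad_lmul // IH linearZ_LR /= scalerA wdeg_cons (bicharDr chiP).
by rewrite (eqP (allP hP _ tP)) !scalerA mulrC.
Qed.

Lemma ev_lmul_nil P (g : A) : ev X P g [::] = ev X P (vacuum k I) [::] * g [::].
Proof.
rewrite /ev !fct_sumE mulr_suml; apply: eq_bigr => t _.
by rewrite !ptE !word_op_lmul_nil /vacuum /= mulr1 mulrA.
Qed.

(** A polynomial that kills the vacuum kills everything: the value at
    a word [j :: v] involves the polynomial and its derivative along [j] at the
    shorter word [v], and derivatives inherit the hypothesis. *)
Lemma ev_vac_eq0 D P :
  homog deg D P -> ev X P (vacuum k I) = 0 -> forall g, ev X P g = 0.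
Proof.
move=> hP P0 g; apply/funext => v; rewrite ptE.
elim: v => [|j v IH] in D P hP P0 g *.
  by rewrite ev_lmul_nil P0 ptE mul0r.
rewrite -[LHS]/(lder j (ev X P g) v) (lder_ev _ _ hP) ptE.
rewrite (IH D) // add0r; apply: (IH _ _ (homog_fder chi j hP)).
have := lder_ev j (vacuum k I) hP.
by rewrite P0 linear0 lder_vac linear0 add0r grad_vac.
Qed.

Section Comparison.

Hypothesis pointed : forall w, wdeg deg w = 0 -> w = [::].

Variables (O : I -> {linear A -> A}) (Q Th : I -> {linear A -> A}).
Variables (s : I -> G -> k) (mu : I -> k).
Hypothesis s0 : forall j, s j 0 = 1.
Hypothesis sD : forall j a b, s j (a + b) = s j a * s j b.
Hypothesis s_neq0 : forall j a, s j a != 0.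
Hypothesis mu_neq0 : forall j, mu j != 0.
Hypothesis Th_surj : forall j g, exists h, Th j h = g.
Hypothesis QO : forall j i g,
  Q j (O i g) = s j (deg i) *: (O i (Q j g) + ((i == j)%:R * mu j) *: Th j g).
Hypothesis ThO : forall j i g,
  Th j (O i g) = (s j (deg i) * chi (deg j) (deg i)) *: O i (Th j g).

(** A relation between the operators [O] holds in the Nichols algebra of [deg]:
    commuting the relation with [Q j] gives the relation for the derivative along
    [j], so all iterated derivatives vanish, and those are the values at words. *)
Lemma ev_transfer D P :
  homog deg D P -> (forall g, ev O P g = 0) -> ev X P (vacuum k I) = 0.
Proof.
move=> hP P0; apply/funext => v; rewrite ptE.
elim: v => [|j v IH] in D P hP P0 *.
  rewrite /ev fct_sumE.
  have [D0|DN0] := eqVneq D 0.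
    have := congr1 (fun g : A => g [::]) (P0 (vacuum k I)).
    rewrite /ev fct_sumE ptE.
    move=> {2}<-; rewrite big_seq [RHS]big_seq; apply: eq_bigr => t tP.
    have -> : t.2 = [::] by apply: pointed; rewrite (eqP (allP hP _ tP)).
    by [].
  rewrite big_seq big1 // => t tP; rewrite ptE word_op_lmul_nil.
  have := allP hP _ tP; case: (t.2) => [|i w] /=; last by rewrite mul0r mulr0.
  by rewrite wdeg_nil eq_sym (negPf DN0).
rewrite -[LHS]/(lder j (ev X P (vacuum k I)) v) (lder_ev _ _ hP).
rewrite lder_vac linear0 add0r grad_vac //.
apply: (IH _ _ (homog_fder chi j hP)) => g.
have [h <-] := Th_surj j g.
have /eqP := leibniz chiP (s0 j) (@sD j) (@QO j) (@ThO j) h hP.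
rewrite !P0 linear0 add0r eq_sym !scaler_eq0 (negPf (s_neq0 _ _)).
by rewrite (negPf (mu_neq0 _)) => /eqP.
Qed.

End Comparison.

End Kernel.

(** * Quantum adjoint generators *)

Section Generators.

Variables (k : fieldType) (n : nat) (I : finType).
Notation G := ('cV[int]_n).
Notation A := (seq I -> k^o).
Notation fsum := (seq (k * seq I)).
Variable deg : I -> G.
Variables (xi : G -> k) (p : I).

Definition gen_degree (j : I) (a : nat) : G := deg j + deg p *+ a.
Notation gdeg := gen_degree.

(** Iterated quantum commutators of [x_p] with [x_j]; [xi] fixes the braiding.
    The elements of these kinds generate the kernel of a skew derivation. *)
Fixpoint gen (j : I) (a : nat) : fsum :=
  if a is b.+1 then
    fpre p (gen j b) ++ fscale (- xi (gdeg j b)) (fpost p (gen j b))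
  else [:: (1, [:: j])].

Lemma gdegS j a : gdeg j a.+1 = deg p + gdeg j a.
Proof. by rewrite /gen_degree mulrS addrCA. Qed.

Lemma gdeg0 j : gdeg j 0 = deg j.
Proof. by rewrite /gen_degree mulr0n addr0. Qed.

Lemma homog_gen j a : homog deg (gdeg j a) (gen j a).
Proof.
elim: a => [|a IH] /=.
  by rewrite /homog /= wdeg_cons wdeg_nil gdeg0 addr0 eqxx.
rewrite homog_cat homog_scale gdegS homog_pre //= addrC.
by rewrite homog_post.
Qed.

Section Ev.

Variable O : I -> {linear A -> A}.

Lemma ev_gen0 j g : ev O (gen j 0) g = O j g.
Proof. by rewrite ev_cons ev_nil addr0 scale1r. Qed.

Lemma ev_genS j a g :
  ev O (gen j a.+1) g =
    O p (ev O (gen j a) g) - xi (gdeg j a) *: ev O (gen j a) (O p g).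
Proof. by rewrite ev_cat ev_pre ev_scale ev_post scaleNr. Qed.

End Ev.

End Generators.

Section Commutation.

Variables (k : fieldType) (n : nat) (I : finType).
Notation G := ('cV[int]_n).
Notation A := (seq I -> k^o).
Variable chi : G -> G -> k.
Hypothesis chiP : bicharacter chi.
Variable deg : I -> G.
Variable p : I.
Notation X := (lmul chi deg).
Notation q := (chi (deg p) (deg p)).
Notation gdeg := (gen_degree deg p).

(** Both [lder p] and [rder p] are instances of [de], with [sg] or [th] trivial;
    the relation between [xi], [sg] and [th] makes [de] commute, up to a scalar,
    with the generators of the corresponding kind. *)
Section OneSided.

Variables (de Th : {linear A -> A}) (sg th : G -> k).
Hypothesis sgD : forall a b, sg (a + b) = sg a * sg b.
Hypothesis thD : forall a b, th (a + b) = th a * th b.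
Hypothesis deX : forall i g,
  de (X i g) = sg (deg i) *: X i (de g) + (i == p)%:R *: Th g.
Hypothesis ThX : forall i g, Th (X i g) = th (deg i) *: X i (Th g).

Variable xi : G -> k.
Hypothesis xiE : forall c, sg c * xi c = th c.
Notation Z := (fun j a => ev X (gen deg xi p j a)).

Lemma Th_gen j a g : Th (Z j a g) = th (gdeg j a) *: Z j a (Th g).
Proof.
elim: a g => [|a IH] g; first by rewrite !ev_gen0 ThX gdeg0.
rewrite !ev_genS linearB linearZ_LR /= ThX !IH ThX evZ linearZ_LR /=.
rewrite gdegS thD; apply/funext => v; rewrite !ptE; ring.
Qed.

Lemma de_gen j a g : j != p ->
  de (Z j a g) = sg (gdeg j a) *: Z j a (de g).
Proof.
move=> jp; elim: a g => [|a IH] g.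
  by rewrite !ev_gen0 deX (negPf jp) scale0r addr0 gdeg0.
rewrite !ev_genS linearB linearZ_LR /= deX eqxx scale1r !IH deX eqxx scale1r.
rewrite Th_gen evD evZ [X p (sg _ *: _)]linearZ_LR /=.
rewrite gdegS sgD; apply/funext => v; rewrite !ptE.
by rewrite -xiE; ring.
Qed.

End OneSided.

End Commutation.

(** * Dimensions of families of functions *)

Section Hull.

Variables (k : fieldType) (I : finType).
Notation A := (seq I -> k^o).
Notation V N := {ffun N.-tuple I -> k^o}.

Definition res N (g : A) : V N := [ffun t : N.-tuple I => g (tval t)].

Lemma res_linear N : linear (res N).
Proof. by move=> c g h; apply/ffunP => t; rewrite !ffunE. Qed.
HB.instance Definition _ N :=
  GRing.isLinear.Build k A (V N) *:%R (res N) (@res_linear N).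

Section Family.

Variables (S : eqType) (fam : S -> A) (P : set S).

Definition comb (L : seq (k * S)) : A := \sum_(t <- L) t.1 *: fam t.2.

(** A function supported on the words of one degree is determined by its values
    at words of one length, so its span can be studied in a finite-dimensional
    space.  The family may be infinite; a finite subfamily of maximal dimension
    spans. *)
Lemma hull_ex N : exists W : {vspace V N},
  (forall s, P s -> res N (fam s) \in W) /\
  exists2 L : seq S, {in L, forall s, P s} &
    W = <<[seq res N (fam s) | s <- L]>>%VS.
Proof.
pose pr d := `[< exists2 L : seq S, {in L, forall s, P s} &
  \dim <<[seq res N (fam s) | s <- L]>> = d >].
have ex0 : exists d, pr d.
  by exists 0%N; apply/asboolP; exists [::] => //; rewrite /= span_nil dimv0.
have ub d : pr d -> (d <= \dim {: V N})%N.
  by move=> /asboolP[L _ <-]; apply: dimvS; apply: subvf.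
case: (ex_maxnP ex0 ub) => d /asboolP[L LP Ld] dmax.
exists <<[seq res N (fam s) | s <- L]>>%VS; split; last by exists L.
move=> s Ps; have := dmax (\dim <<[seq res N (fam s) | s <- s :: L]>>).
rewrite -Ld; have sub : (<<[seq res N (fam s0) | s0 <- L]>> <=
   <<[seq res N (fam s) | s <- s :: L]>>)%VS.
  by rewrite /= span_cons addvSr.
move=> /(_ _)/= h; have /eqP-> : <<[seq res N (fam s0) | s0 <- L]>>%VS ==
   <<[seq res N (fam s) | s <- s :: L]>>%VS.
  rewrite eqEdim sub h //; apply/asboolP; exists (s :: L) => // u.
  by rewrite inE => /predU1P[->|/LP].
by apply: memv_span; rewrite inE eqxx.
Qed.

Definition hull N : {vspace V N} := sval (cid (hull_ex N)).

Definition family_dim N : nat := \dim (hull N).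

Lemma hull_gen N s : P s -> res N (fam s) \in hull N.
Proof. by rewrite /hull; case: cid => /= W [h _]; apply: h. Qed.

Lemma hull_min N (W : {vspace V N}) :
  (forall s, P s -> res N (fam s) \in W) -> (hull N <= W)%VS.
Proof.
move=> h; rewrite /hull; case: cid => /= _ [_ [L LP ->]].
by apply/span_subvP => _ /mapP[s /LP sP ->]; apply: h.
Qed.

Lemma hull_comb N v : v \in hull N ->
  exists2 L : seq (k * S), {in L, forall t, P t.2} & v = res N (comb L).
Proof.
rewrite /hull; case: cid => /= _ [_ [L LP ->]].
elim: L => [|s L IH] in LP v *.
  rewrite /= span_nil memv0 => /eqP->; exists [::] => //.
  by rewrite /comb big_nil linear0.
rewrite /= span_cons => /memv_addP[_ /vlineP[c ->] [w wL ->]].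
have [|L' L'P ->] := IH _ w wL.
  by move=> u uL; apply: LP; rewrite inE uL orbT.
exists ((c, s) :: L') => [t|].
  by rewrite inE => /predU1P[->|/L'P//]; apply: LP; rewrite inE eqxx.
by rewrite /comb big_cons linearD linearZ_LR.
Qed.

Lemma comb_hull N L : {in L, forall t, P t.2} -> res N (comb L) \in hull N.
Proof.
move=> LP; rewrite /comb linear_sum big_seq memv_suml // => t tL.
by rewrite linearZ_LR memvZ // hull_gen //; apply: LP.
Qed.

Lemma free_subseq N (L : seq S) : exists2 L' : seq S, {subset L' <= L} &
  free [seq res N (fam s) | s <- L'] /\
  <<[seq res N (fam s) | s <- L']>>%VS = <<[seq res N (fam s) | s <- L]>>%VS.
Proof.
elim: L => [|s L [L' L'L [fr sp]]]; first by exists [::]; rewrite //= nil_free.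
have [h|h] := boolP (res N (fam s) \in <<[seq res N (fam s) | s <- L]>>%VS).
  exists L'; first by move=> u /L'L uL; rewrite inE uL orbT.
  split=> //; rewrite sp /= span_cons; apply/esym/addv_idPr.
  by rewrite -memvE.
exists (s :: L').
  by move=> u; rewrite !inE => /orP[->//|/L'L->]; rewrite orbT.
by rewrite /= free_cons !span_cons sp h fr.
Qed.

Lemma family_dim_free N : exists2 L : seq S, {in L, forall s, P s} &
  free [seq res N (fam s) | s <- L] /\ size L = family_dim N.
Proof.
rewrite /family_dim /hull; case: cid => /= _ [_ [L LP ->]].
have [L' L'L [fr <-]] := free_subseq N L; exists L' => [s /L'L/LP//|].
by split=> //; move: fr; rewrite /free => /eqP ->; rewrite size_map.
Qed.

End Family.

End Hull.

(** Independent members of the second family come from independent members of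
    the first one, as linear relations transfer. *)
Lemma family_dim_le (k : fieldType) (I J : finType) (S : eqType)
    (fam : S -> seq I -> k^o) (fam' : S -> seq J -> k^o) (P : set S) N N' :
  (forall L, {in L, forall t, P t.2} ->
     res N (comb fam L) = 0 -> res N' (comb fam' L) = 0) ->
  (family_dim fam' P N' <= family_dim fam P N)%N.
Proof.
move=> h; have [L LP [fr <-]] := family_dim_free fam' P N'.
suff frL : free [seq res N (fam s) | s <- L].
  have /eqP := frL; rewrite size_map => <-; apply: dimvS.
  by apply/span_subvP => _ /mapP[s /LP sP ->]; apply: hull_gen.
have combE (T : finType) (f : S -> seq T -> k^o) M (c : 'I_(size L) -> k) :
    res M (comb f [seq (c i, tnth (in_tuple L) i) | i <- enum 'I_(size L)])
    = \sum_(i < size L) c i *: res M (f (tnth (in_tuple L) i)).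
  rewrite /comb big_map linear_sum big_enum; apply: eq_bigr => i _.
  by rewrite linearZ_LR.
have nthE (T : finType) (f : S -> seq T -> k^o) M (i : 'I_(size L)) :
    [seq res M (f s) | s <- L]`_i = res M (f (tnth (in_tuple L) i)).
  rewrite (nth_map (tnth (in_tuple L) i)) ?size_map //.
  by congr (res M (f _)); apply/esym/(tnth_nth _ (in_tuple L)).
apply/(@freeP _ _ _ (map_tuple (fun s => res N (fam s)) (in_tuple L))) => c c0.
apply: (@freeP _ _ _ (map_tuple (fun s => res N' (fam' s)) (in_tuple L)) fr).
have := h [seq (c i, tnth (in_tuple L) i) | i <- enum 'I_(size L)].
rewrite !combE => h0; rewrite -[RHS]h0.
- by apply: eq_bigr => i _; congr (_ *: _); apply: nthE.
- by move=> _ /mapP[i _ ->] /=; apply: LP; apply: mem_tnth.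
- by rewrite -[RHS]c0; apply: eq_bigr => i _; congr (_ *: _); apply/esym/nthE.
Qed.

(** * Factorization of the Nichols algebra at a letter *)

Section Hilbert.

Variables (k : fieldType) (n : nat) (I : finType).
Notation G := ('cV[int]_n).
Notation A := (seq I -> k^o).
Notation fsum := (seq (k * seq I)).
Variable chi : G -> G -> k.
Hypothesis chiP : bicharacter chi.
Variable deg : I -> G.
Variable ht : G -> int.
Hypothesis htD : forall a b, ht (a + b) = ht a + ht b.
Hypothesis ht_deg : forall i, ht (deg i) = 1.
Notation X := (lmul chi deg).
Notation vac := (vacuum k I).

Lemma ht0 : ht 0 = 0.
Proof. exact: additive0. Qed.

Lemma ht_wdeg w : ht (wdeg deg w) = (size w)%:Z.
Proof.
elim: w => [|i w IH]; first by rewrite wdeg_nil ht0.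
by rewrite wdeg_cons htD ht_deg IH /= -add1n PoszD.
Qed.

Lemma pointed_wdeg w : wdeg deg w = 0 -> w = [::].
Proof.
by move=> /(congr1 ht); rewrite ht_wdeg ht0; case: w.
Qed.

Lemma htMn a m : ht (a *+ m) = ht a *+ m.
Proof. by elim: m => [|m IH]; rewrite ?mulr0n ?ht0 // !mulrS htD IH. Qed.

Definition supported (D : G) (g : A) : Prop :=
  forall w, g w != 0 -> wdeg deg w = D.

Lemma supported0 D : supported D 0.
Proof. by move=> w; rewrite ptE eqxx. Qed.

Lemma supportedP D c g h :
  supported D g -> supported D h -> supported D (c *: g + h).
Proof.
move=> hg hh w; rewrite !ptE.
have [->|/hg //] := eqVneq (g w) 0; rewrite mulr0 add0r; exact: hh.
Qed.

Lemma supported_vac : supported 0 vac.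
Proof. by case=> [|i w]; rewrite /vacuum /= ?eqxx // wdeg_nil. Qed.

Lemma supported_lmul D i g : supported D g -> supported (deg i + D) (X i g).
Proof.
move=> hg w; elim: w D g hg => [|j v IH] D g hg; first by rewrite eqxx.
rewrite -[X i g _]/(lder j (X i g) v) lder_lmul !ptE wdeg_cons.
have hj : supported (D - deg j) (lder j g).
  by move=> u /hg; rewrite wdeg_cons => <-; rewrite addrC addKr.
have [e|/(IH _ _ hj) -> _] := eqVneq (X i (lder j g) v) 0; last first.
  by rewrite addrCA [deg j + _]addrC subrK.
rewrite e add0r; case: (eqVneq i j) => [<-|_] /=; last by rewrite mul0r eqxx.
rewrite mul1r /grad mulf_eq0 negb_or => /andP[_ /hg ->] //.
Qed.

Lemma supported_word_op D w g :
  supported D g -> supported (wdeg deg w + D) (word_op X w g).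
Proof.
move=> hg; elim: w => [|i w IH] /=; first by rewrite wdeg_nil add0r.
by rewrite wdeg_cons -addrA; apply: supported_lmul.
Qed.

Lemma supported_ev D E P g :
  homog deg D P -> supported E g -> supported (D + E) (ev X P g).
Proof.
move=> hP hg; rewrite /ev; elim: P hP => [|t P IH] /=.
  by rewrite big_nil => _; apply: supported0.
move=> /andP[/eqP tD hP]; rewrite big_cons; apply: supportedP; last exact: IH.
by rewrite -tD; apply: supported_word_op.
Qed.

Lemma res_inj D g : supported D g -> res `|ht D| g = 0 -> g = 0.
Proof.
move=> hg h; apply/funext => w; rewrite ptE; apply/eqP/negPn/negP => gw.
have sw : size w == `|ht D|%N by rewrite -(hg _ gw) ht_wdeg.
have := congr1 (fun f : {ffun _ -> k^o} => f (Tuple sw)) h.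
by rewrite !ffunE /= => e; rewrite e eqxx in gw.
Qed.

(** Monomials in the generators [gen j a], [j != p], are indexed by the sequences
    of the pairs [(j, a)]. *)
Definition monset (p : I) (D : G) : set (seq (I * nat)) :=
  [set s | all (fun t => t.1 != p) s /\
           \sum_(t <- s) gen_degree deg p t.1 t.2 = D].

Definition nichols_dim (D : G) : nat :=
  family_dim (fun w => word_op X w vac) [set w | wdeg deg w = D] `|ht D|.
Notation hdim := nichols_dim.

Section Factor.

Variables (xi : G -> k) (p : I).

Fixpoint mon (s : seq (I * nat)) : fsum :=
  if s is t :: s' then fmul (gen deg xi p t.1 t.2) (mon s') else [:: (1, [::])].

Definition kernel_dim (D : G) : nat :=
  family_dim (fun s => ev X (mon s) vac) (monset p D) `|ht D|.
Notation kdim := kernel_dim.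

Lemma homog_mon s : homog deg (\sum_(t <- s) gen_degree deg p t.1 t.2) (mon s).
Proof.
elim: s => [|t s IH]; first by rewrite /homog /= big_nil wdeg_nil eqxx.
by rewrite big_cons; apply: homog_mul => //; apply: homog_gen.
Qed.

Lemma ev_mon_nil (O : I -> {linear A -> A}) g : ev O (mon [::]) g = g.
Proof. by rewrite ev_cons ev_nil addr0 scale1r. Qed.

Lemma ev_mon_cons (O : I -> {linear A -> A}) t s g :
  ev O (mon (t :: s)) g = ev O (gen deg xi p t.1 t.2) (ev O (mon s) g).
Proof. exact: ev_mul. Qed.

Definition lincomb (L : seq (k * seq (I * nat))) : fsum :=
  flatten [seq fscale t.1 (mon t.2) | t <- L].

Lemma ev_lincomb (O : I -> {linear A -> A}) L g :
  ev O (lincomb L) g = comb (fun s => ev O (mon s) g) L.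
Proof. by rewrite ev_flatten; apply: eq_bigr => t _; rewrite ev_scale. Qed.

Lemma homog_lincomb D L : {in L, forall t, monset p D t.2} ->
  homog deg D (lincomb L).
Proof.
elim: L => // t L IH LP; rewrite /lincomb /= homog_cat homog_scale.
apply/andP; split; last by apply: IH => u uL; apply: LP; rewrite inE uL orbT.
by have [|_ <-] := LP t; rewrite ?inE ?eqxx // homog_mon.
Qed.

Notation q := (chi (deg p) (deg p)).
Notation pw a := (iter a (X p) vac).

Lemma supported_pw a : supported (deg p *+ a) (pw a).
Proof.
elim: a => [|a IH]; first by rewrite mulr0n; apply: supported_vac.
by rewrite mulrS; apply: supported_lmul.
Qed.

Lemma grad_pw c a : grad chi deg c (pw a) = chi c (deg p) ^+ a *: pw a.
Proof.
elim: a => [|a IH]; first by rewrite grad_vac // scale1r.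
by rewrite iterS grad_lmul // IH linearZ_LR scalerA exprS.
Qed.

Lemma lder_pw i a :
  lder i (pw a.+1) = ((i == p)%:R * qint q a.+1) *: pw a.
Proof.
elim: a => [|a IH].
  rewrite /= lder_lmul lder_vac linear0 add0r grad_vac // eq_sym.
  by rewrite /qint big_ord1 expr0 mulr1.
rewrite [iter a.+2 _ _]iterS lder_lmul IH linearZ_LR /= -[X p (pw a)]/(pw a.+1).
rewrite grad_pw eq_sym.
case: (eqVneq i p) => [->|_] /=; last by rewrite !mul0r !scale0r addr0.
by rewrite !mul1r scalerA mul1r -scalerDl -qintS.
Qed.

(** All derivatives of [x_p ^ b] vanish as soon as the quantum integer [b]
    does. *)
Lemma pw_eq0 a : ~ qnonzero q a -> pw a = 0.
Proof.
move=> /existsNP[b] /not_implyP[/andP[b0 ba]] /negP/negPn/eqP qb.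
have {}b0 : pw b = 0.
  case: b b0 qb {ba} => // b _ qb; apply/funext => -[//|i w].
  rewrite ptE -[LHS]/(lder i (pw b.+1) w) lder_pw qb mulr0 scale0r //.
rewrite -(subnK ba) iterD b0; elim: (a - b)%N => //= m ->.
by rewrite linear0.
Qed.

Definition powmon a (s : seq (I * nat)) : A := ev X (mon s) (pw a).

Lemma comb_powmon a L : comb (powmon a) L = ev X (lincomb L) (pw a).
Proof. by rewrite ev_lincomb. Qed.

Lemma comb_vac L : comb (fun s => ev X (mon s) vac) L = ev X (lincomb L) vac.
Proof. by rewrite ev_lincomb. Qed.

(** Linear combinations of normal ordered products: a monomial in the generators
    of the kernel, followed by a power of [x_p]. *)
Inductive normal : G -> A -> Prop :=
| normal0 D : normal D 0
| normalS D c a s g : monset p (D - deg p *+ a) s -> normal D g ->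
    normal D (c *: powmon a s + g).

Lemma normalP D c g h : normal D g -> normal D h -> normal D (c *: g + h).
Proof.
move=> hg hh; elim: hg hh => [{}D|{}D d a s {}g ms _ IH] hh.
  by rewrite scaler0 add0r.
by rewrite scalerDr -addrA scalerA; apply: normalS => //; apply: IH.
Qed.

Lemma normalD D g h : normal D g -> normal D h -> normal D (g + h).
Proof. by move=> hg hh; rewrite -[g]scale1r; apply: normalP. Qed.

Lemma normalZ D c g : normal D g -> normal D (c *: g).
Proof.
by move=> hg; rewrite -[c *: g]addr0; apply: normalP => //; apply: normal0.
Qed.

Lemma normal1 D a s : monset p (D - deg p *+ a) s -> normal D (powmon a s).
Proof.
move=> ms; rewrite -[powmon a s]scale1r -[1 *: _]addr0.
by apply: normalS => //; apply: normal0.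
Qed.

Lemma normal_gen D j b g :
  j != p -> normal D g ->
  normal (gen_degree deg p j b + D) (ev X (gen deg xi p j b) g).
Proof.
move=> jp; elim=> [{}D|{}D c a s {}g ms _ IH].
  by rewrite ev0; apply: normal0.
rewrite evD evZ; apply: normalP => //.
rewrite /powmon -(ev_mon_cons X (j, b)); apply: normal1.
case: ms => ms1 ms2; split; first by rewrite /= jp ms1.
by rewrite big_cons ms2 addrA.
Qed.

(** [x_p] is moved to the right through each generator: the quantum commutator
    is the next generator. *)
Lemma normal_lmul_p D g : normal D g -> normal (deg p + D) (X p g).
Proof.
elim=> [{}D|{}D c a s {}g [ms1 ms2] _ IH].
  by rewrite linear0; apply: normal0.
rewrite addrC linearD linearZ_LR /= addrC; apply: normalP => // {IH g c}.
elim: s => [|[j b] s IH] in D ms1 ms2 *.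
  rewrite /powmon ev_mon_nil -iterS -(ev_mon_nil X (pw a.+1)); apply: normal1.
  split=> //; rewrite mulrS opprD addrACA subrr add0r -ms2.
  by rewrite !big_nil.
case/andP: ms1 => /= jp ms1.
rewrite /powmon ev_mon_cons -[lmul _ _ _ _](subrK (xi (gen_degree deg p j b) *:
  ev X (gen deg xi p j b) (X p (ev X (mon s) (pw a))))) /= -ev_genS.
move: ms2; rewrite big_cons /= => ms2.
have e2 : \sum_(t <- s) gen_degree deg p t.1 t.2 =
    (D - gen_degree deg p j b) - deg p *+ a.
  by rewrite addrAC -ms2 addrC addKr.
apply: normalD.
  rewrite -(ev_mon_cons X (j, b.+1)); apply: normal1; split.
    exact/andP.
  by rewrite big_cons /= gdegS -[LHS]addrA ms2 addrA.
apply: normalZ.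
have -> : deg p + D = gen_degree deg p j b + (deg p + (D - gen_degree deg p j b)).
  by rewrite addrCA [gen_degree _ _ _ _ + _]addrC subrK.
by apply: normal_gen => //; apply: IH.
Qed.

Lemma normal_word w : normal (wdeg deg w) (word_op X w vac).
Proof.
elim: w => [|i w IH].
  rewrite wdeg_nil -(ev_mon_nil X (word_op X [::] vac)).
  by apply: (@normal1 _ 0); split; rewrite // big_nil mulr0n subr0.
rewrite wdeg_cons /=; case: (eqVneq i p) => [->|ip].
  exact: normal_lmul_p.
by rewrite -(ev_gen0 deg xi p X) -(gdeg0 deg p); apply: normal_gen.
Qed.

Section Count.

Variables (de Th : {linear A -> A}) (sg th : G -> k).
Hypothesis sg0 : sg 0 = 1.
Hypothesis sgD : forall a b, sg (a + b) = sg a * sg b.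
Hypothesis sg_neq0 : forall a, sg a != 0.
Hypothesis thD : forall a b, th (a + b) = th a * th b.
Hypothesis deX : forall i g,
  de (X i g) = sg (deg i) *: X i (de g) + (i == p)%:R *: Th g.
Hypothesis ThX : forall i g, Th (X i g) = th (deg i) *: X i (Th g).
Hypothesis xiE : forall c, sg c * xi c = th c.
Hypothesis de_vac : de vac = 0.
Hypothesis Th_vac : Th vac = vac.
Hypothesis qintE : forall a,
  sg (deg p) * qint q a + th (deg p) ^+ a = qint q a.+1.

Lemma de_mon s g : all (fun t => t.1 != p) s ->
  de (ev X (mon s) g) =
    sg (\sum_(t <- s) gen_degree deg p t.1 t.2) *: ev X (mon s) (de g).
Proof.
elim: s g => [|t s IH] g /=; first by rewrite big_nil sg0 scale1r !ev_mon_nil.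
move=> /andP[tp sp]; rewrite !ev_mon_cons big_cons sgD.
by rewrite (de_gen sgD thD deX ThX xiE) // IH // evZ scalerA.
Qed.

Lemma de_lincomb D L g : {in L, forall t, monset p D t.2} ->
  de (ev X (lincomb L) g) = sg D *: ev X (lincomb L) (de g).
Proof.
move=> LP; rewrite !ev_lincomb /comb linear_sum scaler_sumr.
rewrite big_seq [RHS]big_seq; apply: eq_bigr => t /LP[m1 m2].
by rewrite linearZ_LR /= de_mon // m2 !scalerA mulrC.
Qed.

Lemma Th_pw a : Th (pw a) = th (deg p) ^+ a *: pw a.
Proof.
elim: a => [|a IH]; first by rewrite Th_vac scale1r.
by rewrite iterS ThX IH linearZ_LR scalerA exprS.
Qed.

Lemma de_pw a : de (pw a.+1) = qint q a.+1 *: pw a.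
Proof.
elim: a => [|a IH].
  rewrite /= deX de_vac linear0 scaler0 add0r eqxx scale1r Th_vac.
  by rewrite /qint big_ord1 expr0 scale1r.
rewrite [iter a.+2 _ _]iterS deX IH eqxx scale1r Th_pw linearZ_LR /=.
by rewrite -[X p (pw a)]/(pw a.+1) scalerA -scalerDl qintE.
Qed.

Lemma iter_de_pw a b : (a < b)%N -> iter b de (pw a) = 0.
Proof.
have z m : iter m de 0 = 0 by elim: m => //= m ->; rewrite linear0.
elim: a b => [|a IH] [|b] //; first by rewrite iterSr /= de_vac z.
rewrite ltnS iterSr de_pw => /IH h.
have zl m c g : iter m de (c *: g) = c *: iter m de g.
  by elim: m => //= m ->; rewrite linearZ_LR.
by rewrite zl h scaler0.
Qed.

Lemma iter_deZ m c g : iter m de (c *: g) = c *: iter m de g.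
Proof. by elim: m => //= m ->; rewrite linearZ_LR. Qed.

Lemma iter_de_pw_eq a : qnonzero q a ->
  exists2 c, c != 0 & iter a de (pw a) = c *: vac.
Proof.
elim: a => [|a IH] h; first by exists 1; rewrite ?oner_neq0 // scale1r.
have [|c c0 e] := IH.
  by move=> b /andP[b0 ba]; apply: h; rewrite b0 (leq_trans ba).
exists (qint q a.+1 * c); first by rewrite mulf_neq0 // h //=.
by rewrite iterSr de_pw iter_deZ e scalerA.
Qed.

Lemma iter_de_lincomb D L m g : {in L, forall t, monset p D t.2} ->
  iter m de (ev X (lincomb L) g) =
    sg D ^+ m *: ev X (lincomb L) (iter m de g).
Proof.
move=> LP; elim: m => [|m IH]; first by rewrite scale1r.
by rewrite iterS IH linearZ_LR /= (de_lincomb _ LP) scalerA exprSr.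
Qed.

(** [de] does not see the kernel factor, so its [a]-th power turns [x_p ^ a] into
    a nonzero constant and leaves the combination of monomials alone. *)
Lemma lincomb_pw_eq0 D L a g : {in L, forall t, monset p D t.2} ->
  qnonzero q a -> iter a de (ev X (lincomb L) (pw a)) = 0 ->
  ev X (lincomb L) g = 0.
Proof.
move=> LP /iter_de_pw_eq[c c0 e].
rewrite (iter_de_lincomb _ _ LP) e evZ scalerA => /eqP.
rewrite scaler_eq0 mulf_eq0 (negPf c0) orbF expf_eq0 (negPf (sg_neq0 _)).
rewrite andbF /= => /eqP h.
exact: (ev_vac_eq0 chiP (homog_lincomb LP)).
Qed.

Lemma iter_de0 m : iter m de 0 = 0.
Proof. by elim: m => //= m ->; rewrite linear0. Qed.

Lemma supported_comb_powmon D a L :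
  {in L, forall t, monset p (D - deg p *+ a) t.2} ->
  supported D (comb (powmon a) L).
Proof.
move=> LP; rewrite comb_powmon -(subrK (deg p *+ a) D).
by apply: supported_ev; [exact: homog_lincomb | exact: supported_pw].
Qed.

(** Right multiplication by a surviving power of [x_p] is injective on the
    kernel. *)
Lemma family_dim_powmon a D : qnonzero q a ->
  family_dim (powmon a) (monset p (D - deg p *+ a)) `|ht D| =
  kdim (D - deg p *+ a).
Proof.
move=> qa; apply/eqP; rewrite eqn_leq; apply/andP.
split; apply: family_dim_le => L LP.
  rewrite comb_vac comb_powmon => h.
  have hs : supported (D - deg p *+ a) (ev X (lincomb L) vac).
    rewrite -[D - _]addr0; apply: supported_ev; first exact: homog_lincomb.
    exact: supported_vac.
  by rewrite (ev_vac_eq0 chiP (homog_lincomb LP) (res_inj hs h)) linear0.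
move=> h; have := res_inj (supported_comb_powmon LP) h.
rewrite comb_powmon comb_vac => e; rewrite (lincomb_pw_eq0 _ LP qa) ?linear0 //.
by rewrite e iter_de0.
Qed.

Lemma hull_words D :
  hull (fun w => word_op X w vac) [set w | wdeg deg w = D] `|ht D| =
  (\sum_(a < `|ht D|.+1 | `[< qnonzero q a >])
     hull (powmon a) (monset p (D - deg p *+ a)) `|ht D|)%VS.
Proof.
apply/eqP; rewrite eqEsubv; apply/andP; split.
  apply: hull_min => w wD.
  have : normal D (word_op X w vac) by rewrite -wD; apply: normal_word.
  move: (word_op X w vac) => g; elim => [{}D|{}D c a s {}g [ms1 ms2] _ IH] {w wD}.
    by rewrite linear0 mem0v.
  rewrite linearD linearZ_LR memvD // memvZ //.
  have [qa|qa] := pselect (qnonzero q a); last first.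
    by rewrite /powmon pw_eq0 // ev0 linear0 mem0v.
  have aD : (a < `|ht D|.+1)%N.
    have : ht D = ht (\sum_(t <- s) gen_degree deg p t.1 t.2) + a%:Z.
      by rewrite ms2 -[in LHS](subrK (deg p *+ a) D) htD htMn ht_deg natz.
    have : 0 <= ht (\sum_(t <- s) gen_degree deg p t.1 t.2).
      elim: s {ms1 ms2} => [|t s IHs]; first by rewrite big_nil ht0.
      by rewrite big_cons htD addr_ge0 // /gen_degree htD htMn !ht_deg natz; lia.
    lia.
  apply: (subvP (sumv_sup (Ordinal aD) _ (subvv _))); first exact/asboolP.
  exact: hull_gen.
apply/subv_sumP => a /asboolP qa; apply: hull_min => s ms.
have -> : powmon a s =
    comb (fun w => word_op X w vac) (fmul (mon s) [:: (1, nseq a p)]).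
  rewrite -[RHS]/(ev X _ vac) ev_mul ev_cons ev_nil addr0 scale1r /powmon.
  by congr (ev X _ _); elim: (val a) => //= m ->.
apply: comb_hull => t tm.
have /allP/(_ _ tm)/eqP // : homog deg D (fmul (mon s) [:: (1, nseq a p)]).
suff: homog deg (D - deg p *+ a + deg p *+ a) (fmul (mon s) [:: (1, nseq a p)]).
  by rewrite subrK.
apply: homog_mul.
  by case: ms => _ <-; apply: homog_mon.
rewrite /homog /= andbT; apply/eqP.
by elim: (val a) => [|m IH] /=; rewrite ?wdeg_nil ?mulr0n // wdeg_cons IH mulrS.
Qed.

(** In a vanishing sum, look at the highest power [a] of [x_p] with a nonzero
    coefficient: [a] derivations kill the lower powers. *)
Lemma directv_powmon D : directv (\sum_(a < `|ht D|.+1 | `[< qnonzero q a >])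
     hull (powmon a) (monset p (D - deg p *+ a)) `|ht D|)%VS.
Proof.
apply/directv_sum_independent => us usW us0.
pose N := `|ht D|%N.
have /choice[L LP] : forall a : 'I_N.+1, exists L : seq (k * seq (I * nat)),
    `[< qnonzero q a >] ->
    {in L, forall t, monset p (D - deg p *+ a) t.2} /\
    us a = res N (comb (powmon a) L).
  move=> a; have [qa|qa] := boolP `[< qnonzero q a >]; last by exists [::].
  by have [L LP e] := hull_comb (usW a qa); exists L.
pose F (a : 'I_N.+1) := comb (powmon a) (L a).
have F0 : \sum_(a < N.+1 | `[< qnonzero q a >]) F a = 0.
  apply: (@res_inj D).
    apply: big_ind => [|u v su sv|a qa]; first exact: supported0.
      by rewrite -[u]scale1r; apply: supportedP.
    by case: (LP a qa) => h _; apply: supported_comb_powmon.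
  by rewrite linear_sum -[RHS]us0; apply: eq_bigr => a qa; case: (LP a qa).
have key (m : nat) : forall a : 'I_N.+1, `[< qnonzero q a >] -> (N - a < m)%N ->
    forall g, ev X (lincomb (L a)) g = 0.
  elim: m => // m IH a qa am g; have [LPa _] := LP a qa.
  apply: (lincomb_pw_eq0 _ LPa (asboolW qa)).
  have := congr1 (iter a de) F0; rewrite iter_de0.
  have itD b : {morph iter b de : u v / u + v}.
    by elim: b => // b IHb u v; rewrite !iterS IHb linearD.
  rewrite (big_morph _ (itD a) (iter_de0 a)) (bigD1 a) //= /F comb_powmon.
  rewrite big1 ?addr0 //.
  move=> b /andP[qb ba]; have [LPb _] := LP b qb; rewrite comb_powmon.
  have [lt_ba|lt_ab|e] := ltngtP b a; last by rewrite (val_inj e) eqxx in ba.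
    by rewrite (iter_de_lincomb _ _ LPb) iter_de_pw // ev0 scaler0.
  rewrite IH ?iter_de0 //; have := ltn_ord b; have := ltn_ord a; move: am lt_ab.
  by clear; lia.
move=> a qa; have [_ ->] := LP a qa.
by rewrite comb_powmon (key N.+1) // ?linear0 // ltnS leq_subr.
Qed.

Lemma nichols_dim_factor D : hdim D =
  (\sum_(a < `|ht D|.+1 | `[< qnonzero q a >]) kdim (D - deg p *+ a))%N.
Proof.
rewrite /nichols_dim /family_dim hull_words (directvP (directv_powmon D)) /=.
by apply: eq_bigr => a /asboolP qa; rewrite -family_dim_powmon.
Qed.

End Count.

End Factor.

End Hilbert.

(** * The two kernels at a letter *)

Section TwoTypes.

Variables (k : fieldType) (n : nat) (I : finType).
Notation G := ('cV[int]_n).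
Notation A := (seq I -> k^o).
Variable chi : G -> G -> k.
Hypothesis chiP : bicharacter chi.
Variable deg : I -> G.
Variable ht : G -> int.
Hypothesis htD : forall a b, ht (a + b) = ht a + ht b.
Hypothesis ht_deg : forall i, ht (deg i) = 1.
Notation X := (lmul chi deg).
Notation q p := (chi (deg p) (deg p)).

(** The commutators adapted to [lder p] and to [rder p]. *)
Definition xiL (p : I) (c : G) : k := chi (deg p) c.
Definition xiR (p : I) (c : G) : k := (chi c (deg p))^-1.

Notation hdim := (nichols_dim chi deg ht).
Notation kdim := (kernel_dim chi deg ht).

Lemma nichols_dim_factorL p D : hdim D =
  (\sum_(a < `|ht D|.+1 | `[< qnonzero (q p) a >])
     kdim (xiL p) p (D - deg p *+ a))%N.
Proof.
apply: (nichols_dim_factor chiP htD ht_deg (xi := xiL p) (p := p) (de := lder p)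
  (Th := grad chi deg (deg p)) (sg := fun=> 1) (th := chi (deg p))) => //.
- by move=> a b; rewrite mulr1.
- by move=> a; rewrite oner_neq0.
- exact: bicharDr.
- by move=> i g; rewrite scale1r -lder_lmul.
- by move=> i g; rewrite -grad_lmul.
- by move=> c; rewrite mul1r.
- exact: grad_vac.
- by move=> a; rewrite mul1r -qintS.
Qed.

Lemma nichols_dim_factorR p D : hdim D =
  (\sum_(a < `|ht D|.+1 | `[< qnonzero (q p) a >])
     kdim (xiR p) p (D - deg p *+ a))%N.
Proof.
apply: (nichols_dim_factor chiP htD ht_deg (xi := xiR p) (p := p) (de := rder p)
  (Th := idfun) (sg := fun c => chi c (deg p)) (th := fun=> 1)) => //.
- exact: bichar0l.
- by move=> a b; apply: (bicharDl chiP).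
- by move=> a; apply: (bichar_neq0 chiP).
- by move=> a b; rewrite mulr1.
- by move=> i g; rewrite -rder_lmul.
- by move=> i g; rewrite scale1r.
- by move=> c; rewrite divff // (bichar_neq0 chiP).
- exact: rder_vac.
- by move=> a; rewrite expr1n addrC -qintSl.
Qed.

Lemma kernel_dim_neq0 xi p D : kdim xi p D != 0%N -> exists w, D = wdeg deg w.
Proof.
move=> kD; have [s [_ <-]] : exists s, monset deg p D s.
  apply: contrapT => h; move/eqP: kD; apply.
  rewrite /kernel_dim /family_dim; set W := hull _ _ _.
  suff : (W <= 0)%VS by rewrite subv0 => /eqP ->; rewrite dimv0.
  by apply: hull_min => s ms; case: h; exists s.
elim: s => [|t s [w IH]]; first by exists [::]; rewrite big_nil wdeg_nil.
exists (t.1 :: nseq t.2 p ++ w).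
rewrite big_cons IH wdeg_cons wdeg_cat addrA; congr (_ + _ + _).
by elim: (t.2) => [|m IHm]; rewrite ?wdeg_nil //= wdeg_cons -IHm mulrS.
Qed.

Lemma kernel_dim_neg xi p D : ht D < 0 -> kdim xi p D = 0%N.
Proof.
move=> D0; apply/eqP/negPn/negP => /kernel_dim_neq0[w Dw]; move: D0.
by rewrite Dw (ht_wdeg htD ht_deg).
Qed.

(** Both kernels have the same cofactor in the Nichols algebra, and the equations
    [nichols_dim_factorL] and [nichols_dim_factorR] determine them by recursion on
    the height. *)
Lemma kernel_dim_LR p D : kdim (xiL p) p D = kdim (xiR p) p D.
Proof.
have [D0|D0] := ltP (ht D) 0; first by rewrite !kernel_dim_neg.
move e : `|ht D|%N => m; elim/ltn_ind: m => m IH in D D0 e *.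
have q0 : `[< qnonzero (q p) 0 >] by apply/asboolP => -[].
have := nichols_dim_factorL p D; rewrite (nichols_dim_factorR p).
pose z := @Ordinal `|ht D|.+1 0 isT.
rewrite (bigD1 z) // [in RHS](bigD1 z) //= mulr0n subr0 => /eqP.
set s1 := (X in _ == (_ + X)%N); set s2 := (X in (_ + X == _)%N).
have -> : s1 = s2; last by rewrite eqn_add2r => /eqP.
apply: eq_bigr => a /andP[_ a0].
have ha : ht (D - deg p *+ a) = ht D - a%:Z.
  apply: (addIr (ht (deg p *+ a))).
  by rewrite -htD subrK (htMn htD) ht_deg natz subrK.
have := ltn_ord a; move: a0; rewrite -val_eqE /= => a0 aD.
by apply: (IH `|ht D - a%:Z|%N); rewrite ?ha; lia.
Qed.

End TwoTypes.

(** * Quantum Serre relations *)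

Section Reflection.

Variables (k : fieldType) (n : nat) (I : finType).
Notation G := ('cV[int]_n).
Notation A := (seq I -> k^o).
Variable chi : G -> G -> k.
Hypothesis chiP : bicharacter chi.

(** With [q = chi(p,p)] and [r = chi(p,j) chi(j,p)], this holds for the
    number [m(p, j)] of the reflection at [p] ([refl_cond_min]).  The product in the
    last clause is the coefficient in [rder_gen_p]. *)
Definition refl_cond (q r : k) (m : nat) : Prop :=
  [/\ qnonzero q m, forall a, (a < m)%N -> q ^+ a * r != 1 &
      qint q m.+1 * (1 - q ^+ m * r) = 0].

Section Serre.

Variables (deg : I -> G) (p : I).
Notation X := (lmul chi deg).
Notation q := (chi (deg p) (deg p)).
Notation r j := (chi (deg p) (deg j) * chi (deg j) (deg p)).
Notation gdeg := (gen_degree deg p).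
Notation Z j a := (ev X (gen deg (xiL chi deg p) p j a)).

Lemma chi_gdegl j a c : chi (gdeg j a) c = chi (deg j) c * chi (deg p) c ^+ a.
Proof. by rewrite /gen_degree (bicharDl chiP) (bicharMnl chiP). Qed.

Lemma chi_gdegr j a c : chi c (gdeg j a) = chi c (deg j) * chi c (deg p) ^+ a.
Proof. by rewrite /gen_degree (bicharDr chiP) (bicharMnr chiP). Qed.

Lemma genZS j a g :
  Z j a.+1 g = X p (Z j a g) - chi (deg p) (gdeg j a) *: Z j a (X p g).
Proof. exact: ev_genS. Qed.

Lemma rderBZ i (u v : A) c : rder i (u - c *: v) = rder i u - c *: rder i v.
Proof. by []. Qed.

Lemma lderBZ i (u v : A) c : lder i (u - c *: v) = lder i u - c *: lder i v.
Proof. by []. Qed.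

(** The recursion for the coefficient is [c_(a+1) = q c_a + 1 - q^(2a) r]. *)
Lemma rder_gen_p j a g : j != p ->
  rder p (Z j a g) = chi (gdeg j a) (deg p) *: Z j a (rder p g)
    + (qint q a * (1 - q ^+ a.-1 * r j)) *: Z j a.-1 g.
Proof.
move=> jp; elim: a g => [|a IH] g.
  by rewrite !ev_gen0 rder_lmul // (negPf jp) qint0 mul0r scale0r gdeg0 scale0r.
rewrite !genZS rderBZ rder_lmul // eqxx scale1r !IH.
rewrite rder_lmul // eqxx scale1r evD evZ /=.
case: a IH => [|a] _.
  rewrite qint0 mul0r !scale0r !ev_gen0 !chi_gdegl !chi_gdegr /qint big_ord1.
  rewrite ?expr0 ?expr1.
  rewrite [X p (_ + 0)]linearD linear0 linearZ_LR /=.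
  by apply/funext => v; rewrite !ptE; ring.
rewrite -[a.+1.-1]/a lmulD !lmulZ.
rewrite [in RHS]qintSl [ev _ _ g in RHS]genZS.
rewrite [ev _ (gen _ _ _ _ a.+1) g in LHS]genZS.
rewrite !chi_gdegl !chi_gdegr.
(* The two sides differ by a multiple of this relation between quantum
   integers. *)
have e : qint q a.+1 + q * q ^+ a - (1 + q * qint q a.+1) = 0.
  by rewrite -qintSl [qint q a.+2]qintS exprS subrr.
apply/funext => v; rewrite !ptE !exprS; apply/eqP; rewrite -subr_eq0; apply/eqP.
transitivity (- r j * q * q ^+ a * (X p (Z j a g) v -
  chi (deg p) (deg j) * q ^+ a * Z j a (X p g) v) *
  (qint q a.+1 + q * q ^+ a - (1 + q * qint q a.+1))); last by rewrite e mulr0.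
ring.
Qed.

Lemma rder_gen i j a g : i != p ->
  rder i (Z j a g) = chi (gdeg j a) (deg i) *: Z j a (rder i g)
    + ((j == i) && (a == 0)%N)%:R *: g.
Proof.
move=> ip; elim: a g => [|a IH] g.
  by rewrite !ev_gen0 rder_lmul // gdeg0 andbT.
rewrite !genZS rderBZ rder_lmul // [p == i]eq_sym (negPf ip).
rewrite scale0r addr0 !IH rder_lmul // [p == i]eq_sym (negPf ip) scale0r addr0.
rewrite andbF scale0r addr0 evZ lmulD !lmulZ.
rewrite !chi_gdegl !chi_gdegr.
apply/funext => v; rewrite !ptE !exprS.
case: eqVneq => [->|_]; case: (eqVneq a 0%N) => [->|_] /=; rewrite ?expr0; ring.
Qed.

(** The generator after the last one is killed by every [rder], hence vanishes at
    every word. *)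
Lemma serre j m g : j != p -> refl_cond q (r j) m -> Z j m.+1 g = 0.
Proof.
move=> jp [_ _ h]; apply/funext => v; rewrite ptE.
elim/last_ind: v g => [|v i IH] g.
  by rewrite genZS !ptE lmul_nil ev_lmul_nil lmul_nil; ring.
rewrite -[LHS]/(rder i (Z j m.+1 g) v); case: (eqVneq i p) => [->|ip].
  by rewrite rder_gen_p // h scale0r addr0 ptE IH mulr0.
by rewrite rder_gen // andbF scale0r addr0 ptE IH mulr0.
Qed.

Lemma lder_gen_p j a g : j != p -> lder p (Z j a g) = Z j a (lder p g).
Proof.
move=> jp; rewrite (@de_gen _ _ _ chi deg p (lder p) (grad chi deg (deg p))
  (fun=> 1) (chi (deg p))) ?scale1r //.
- by move=> a' b; rewrite mulr1.
- exact: bicharDr.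
- by move=> i h; rewrite scale1r -lder_lmul.
- by move=> i h; rewrite -grad_lmul.
- by move=> c; rewrite mul1r.
Qed.

Lemma iter_lmulZ a c g : iter a (X p) (c *: g) = c *: iter a (X p) g.
Proof. by elim: a => //= a ->; rewrite linearZ_LR. Qed.

Lemma lder_gen i j a g : i != p ->
  lder i (Z j a g) = Z j a (lder i g) + ((j == i)%:R *
     \prod_(c < a) (1 - q ^+ c * r j)) *: iter a (X p) (grad chi deg (deg i) g).
Proof.
move=> ip; elim: a g => [|a IH] g.
  by rewrite !ev_gen0 lder_lmul big_ord0 mulr1.
have dX h : lder i (X p h) = X p (lder i h).
  by rewrite lder_lmul [p == i]eq_sym (negPf ip) scale0r addr0.
rewrite !genZS lderBZ dX !IH dX big_ord_recr /=.
rewrite lmulD lmulZ grad_lmul // iter_lmulZ.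
rewrite -iterSr /= chi_gdegr; case: (eqVneq j i) => [->|_] /=.
  by apply/funext => v; rewrite !ptE; ring.
by apply/funext => v; rewrite !ptE; ring.
Qed.

Lemma lder_iter a g : lder p (iter a (X p) g) = iter a (X p) (lder p g)
    + qint q a *: iter a.-1 (X p) (grad chi deg (deg p) g).
Proof.
elim: a g => [|a IH] g; first by rewrite qint0 scale0r addr0.
rewrite iterSr IH lder_lmul eqxx scale1r grad_lmul // iter_lmulZ qintSl.
have itD b : {morph iter b (X p) : u v / u + v}.
  by elim: b => // b IHb u v; rewrite !iterS IHb linearD.
rewrite itD -iterSr; case: a IH => [|a] _ /=.
  by rewrite qint0 scale0r mulr0 !addr0 scale1r.
rewrite -[iter a (X p) (X p _)]iterSr /=.
by apply/funext => v; rewrite !ptE; ring.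
Qed.

End Serre.

End Reflection.

(** * The operators dual to the generators *)

Section DualGenerator.

Variables (k : fieldType) (n : nat) (I : finType).
Notation G := ('cV[int]_n).
Notation A := (seq I -> k^o).
Variable chi : G -> G -> k.
Hypothesis chiP : bicharacter chi.
Variables (deg : I -> G) (p : I).
Notation X := (lmul chi deg).
Notation q := (chi (deg p) (deg p)).
Notation r j := (chi (deg p) (deg j) * chi (deg j) (deg p)).
Notation gdeg := (gen_degree deg p).
Notation Z j a := (ev X (gen deg (xiL chi deg p) p j a)).

(** The same commutators, built from the derivations [lder] instead of the
    multiplications.  They commute with [rder] and with the generators of the other
    letters. *)
Fixpoint dualgen (j : I) (a : nat) : {linear A -> A} :=
  if a is b.+1 then
    (lder p \o dualgen j b) \-
    (chi (gdeg j b) (deg p) \*: (dualgen j b \o lder p))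
  else lder j.

Lemma dualgenS j a g : dualgen j a.+1 g =
  lder p (dualgen j a g) - chi (gdeg j a) (deg p) *: dualgen j a (lder p g).
Proof. by []. Qed.

Lemma lderD i (g h : A) : lder i (g + h) = lder i g + lder i h.
Proof. by []. Qed.

Lemma lderZ i c (g : A) : lder i (c *: g) = c *: lder i g.
Proof. by []. Qed.

Lemma dualgen_rder j a i g : dualgen j a (rder i g) = rder i (dualgen j a g).
Proof. by elim: a g => [|a IH] g //; rewrite !dualgenS IH !lder_rder IH. Qed.

Lemma dualgen_gen j a i b g : i != p -> i != j -> j != p ->
  dualgen j a (Z i b g) = Z i b (dualgen j a g).
Proof.
move=> ip ij jp; elim: a g => [|a IH] g.
  by rewrite /= lder_gen // (negPf ij) mul0r scale0r addr0.
by rewrite !dualgenS IH !lder_gen_p // IH evB evZ.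
Qed.

(** At [a = m] the power of [x_p] disappears, and pairing the top dual generator
    with the top generator leaves a grading operator. *)
Lemma dualgen_gen_eq j a m g : j != p -> (a <= m)%N ->
  dualgen j a (Z j m g) = Z j m (dualgen j a g) +
    (\prod_(c < m) (1 - q ^+ c * r j) * \prod_(c < a) qint q (m - c)) *:
      iter (m - a) (X p) (grad chi deg (gdeg j a) g).
Proof.
move=> jp; elim: a g => [|a IH] g am.
  by rewrite /= lder_gen // eqxx mul1r big_ord0 mulr1 subn0 gdeg0.
rewrite !dualgenS IH ?(ltnW am) // lderD lder_gen_p // lderZ lder_iter //.
rewrite lder_gen_p // IH ?(ltnW am) // evB evZ big_ord_recr /= lder_grad //.
rewrite iter_lmulZ subnS.
have -> : grad chi deg (deg p) (grad chi deg (gdeg j a) g) =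
    grad chi deg (gdeg j a.+1) g.
  by apply/funext => v; rewrite /grad mulrA -(bicharDl chiP) -gdegS.
by apply/funext => v; rewrite !ptE; ring.
Qed.

End DualGenerator.

(** * Comparison of the kernels under a reflection *)

Section Reflect.

Variables (k : fieldType) (n : nat) (I : finType).
Notation G := ('cV[int]_n).
Notation A := (seq I -> k^o).
Variable chi : G -> G -> k.
Hypothesis chiP : bicharacter chi.
Variables (deg deg' : I -> G) (p : I) (m : I -> nat).
Variables (ht ht' : G -> int).
Hypothesis htD : forall a b, ht (a + b) = ht a + ht b.
Hypothesis ht_deg : forall i, ht (deg i) = 1.
Hypothesis ht'D : forall a b, ht' (a + b) = ht' a + ht' b.
Hypothesis ht'_deg : forall i, ht' (deg' i) = 1.
Hypothesis deg'p : deg' p = - deg p.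
Hypothesis deg'j : forall j, j != p -> deg' j = deg j + deg p *+ m j.
Notation X := (lmul chi deg).
Notation q := (chi (deg p) (deg p)).
Notation r j := (chi (deg p) (deg j) * chi (deg j) (deg p)).
Hypothesis refl : forall j, j != p -> refl_cond q (r j) (m j).
Notation Z j a := (ev X (gen deg (xiL chi deg p) p j a)).

(** The generators of the reflected Nichols algebra, as operators on the functions
    for the original base: the letter [p], now of opposite degree, acts as a
    derivation, and every other letter as its top generator.  Their partners
    [refl_der] satisfy the Leibniz rule for the reflected degrees: multiplication
    by [x_p] for the letter [p], the top dual generators for the others. *)
Definition refl_gen (i : I) : {linear A -> A} :=
  if i == p then (rder p : {linear A -> A}) else (Z i (m i) : {linear A -> A}).

Definition refl_der (i : I) : {linear A -> A} :=
  if i == p then (X p : {linear A -> A}) else dualgen chi deg p i (m i).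

Definition refl_grad (i : I) : {linear A -> A} :=
  if i == p then (idfun : {linear A -> A})
  else (grad chi deg (deg' i) : {linear A -> A}).

Definition refl_scal (i : I) (c : G) : k :=
  if i == p then chi (deg p) c else 1.

Definition refl_cst (i : I) : k :=
  if i == p then -1 else
  \prod_(c < m i) (1 - q ^+ c * r i) * \prod_(c < m i) qint q (m i - c).

Lemma refl_gen_p g : refl_gen p g = rder p g.
Proof. by rewrite /refl_gen eqxx. Qed.

Lemma refl_gen_j j g : j != p -> refl_gen j g = Z j (m j) g.
Proof. by rewrite /refl_gen => /negPf->. Qed.

Lemma refl_cst_neq0 j : refl_cst j != 0.
Proof.
rewrite /refl_cst; case: (eqVneq j p) => jp; first by rewrite oppr_eq0 oner_neq0.
have [h1 h2 _] := refl jp; rewrite mulf_neq0 //.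
  by apply/prodf_neq0 => c _; rewrite subr_eq0 eq_sym h2.
by apply/prodf_neq0 => c _; apply: h1; rewrite subn_gt0 ltn_ord leq_subr.
Qed.

(** For [j = p] and [i != p] this is the Serre relation. *)
Lemma refl_der_gen j i g : refl_der j (refl_gen i g) =
  refl_scal j (deg' i) *: (refl_gen i (refl_der j g) +
     ((i == j)%:R * refl_cst j) *: refl_grad j g).
Proof.
rewrite /refl_der /refl_scal /refl_cst /refl_grad.
have qn0 : q != 0 by apply: bichar_neq0.
case: (eqVneq j p) => [->|jp]; case: (eqVneq i p) => [->|ip].
- rewrite !refl_gen_p deg'p bicharNr // rder_lmul // eqxx.
  by apply/funext => v; rewrite !ptE /=; field.
- rewrite !refl_gen_j // mul0r scale0r addr0 deg'j //.
  have /eqP := serre chiP g ip (refl ip).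
  by rewrite genZS subr_eq0 => /eqP.
- rewrite !refl_gen_p scale1r [p == j]eq_sym (negPf jp) mul0r scale0r addr0.
  exact: dualgen_rder.
- rewrite !refl_gen_j // scale1r; case: (eqVneq i j) => [->|ij].
    by rewrite dualgen_gen_eq // subnn mul1r deg'j.
  by rewrite mul0r scale0r addr0 dualgen_gen.
Qed.

Lemma refl_grad_gen j i g : refl_grad j (refl_gen i g) =
  (refl_scal j (deg' i) * chi (deg' j) (deg' i)) *: refl_gen i (refl_grad j g).
Proof.
rewrite /refl_grad /refl_scal; case: (eqVneq j p) => [->|jp].
  by rewrite deg'p bicharNl // divff ?scale1r // bichar_neq0.
rewrite mul1r; case: (eqVneq i p) => [->|ip].
  rewrite !refl_gen_p rder_grad // scalerA deg'p bicharNr // mulVf ?scale1r //.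
  exact: bichar_neq0.
rewrite !refl_gen_j //= (grad_ev chiP _ _ (homog_gen _ _ _ _ _)).
by rewrite [deg' i]deg'j.
Qed.

Lemma refl_gen_transfer D P : homog deg' D P -> (forall g, ev refl_gen P g = 0) ->
  ev (lmul chi deg') P (vacuum k I) = 0.
Proof.
apply: (@ev_transfer _ _ _ _ chiP deg' (pointed_wdeg ht'D ht'_deg) refl_gen
  refl_der refl_grad refl_scal refl_cst).
- by move=> j; rewrite /refl_scal; case: ifP => // _; apply: (bichar0r chiP).
- move=> j a b; rewrite /refl_scal; case: ifP => // _; last by rewrite mulr1.
  exact: (bicharDr chiP).
- move=> j a; rewrite /refl_scal; case: ifP => // _; rewrite ?oner_neq0 //.
  exact: (bichar_neq0 chiP).
- exact: refl_cst_neq0.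
- move=> j g; rewrite /refl_grad; case: ifP => _; first by exists g.
  by exists (grad chi deg (- deg' j) g); apply: grad_surj.
- exact: refl_der_gen.
- exact: refl_grad_gen.
Qed.

Notation gen' j a := (gen deg' (xiR chi deg' p) p j a).

(** A derivation along [p] lowers the generators, so the reflected commutators
    run through the original generators backwards, from the top one down to
    [x_j], and then vanish. *)
Lemma refl_gen_gen j a : j != p -> exists2 c,
  ((m j < a)%N -> c = 0) &
  forall g, ev refl_gen (gen' j a) g = c *: Z j (m j - a) g.
Proof.
move=> jp; elim: a => [|a [c c0 IH]].
  by exists 1 => // g; rewrite ev_gen0 refl_gen_j // subn0 scale1r.
have [ma|am] := ltnP (m j) a.+1.
  exists 0 => // g; rewrite scale0r ev_genS refl_gen_p !IH.
  have [{}ma|am] := ltnP (m j) a.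
    by rewrite c0 // !scale0r linear0 scaler0 subr0.
  have -> : a = m j by apply/eqP; rewrite eqn_leq am -ltnS ma.
  rewrite subnn !ev_gen0 refl_gen_p /xiR /gen_degree deg'p deg'j // mulNrn addrK.
  rewrite bicharNr // invrK -[rder p _]/(c *: rder p (X j g)) rder_lmul //.
  by rewrite (negPf jp) scale0r addr0 !scalerA mulrC subrr.
exists (c * (qint q (m j - a) * (1 - q ^+ (m j - a).-1 * r j))).
  by [].
move=> g; rewrite ev_genS !IH refl_gen_p.
rewrite -[rder p _ in LHS]/(c *: rder p (Z j (m j - a) g)).
rewrite refl_gen_p rder_gen_p // -subnS /xiR deg'p bicharNr // invrK.
have -> : gen_degree deg' p j a = gen_degree deg p j (m j - a).
  rewrite /gen_degree deg'p deg'j // mulNrn -addrA; congr (_ + _).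
  by rewrite mulrnBr // ltnW.
by apply/funext => v; rewrite !ptE; ring.
Qed.

(** This change of index preserves the degree of a generator [gen j a] with
    [a <= m j]; the reflected generators beyond act as zero. *)
Definition reflect_index (s : seq (I * nat)) : seq (I * nat) :=
  [seq (t.1, (m t.1 - t.2)%N) | t <- s].

Lemma refl_gen_mon s : all (fun t => t.1 != p) s -> exists2 c,
  c != 0 -> \sum_(t <- reflect_index s) gen_degree deg p t.1 t.2 =
            \sum_(t <- s) gen_degree deg' p t.1 t.2 &
  forall g, ev refl_gen (mon deg' (xiR chi deg' p) p s) g =
     c *: ev X (mon deg (xiL chi deg p) p (reflect_index s)) g.
Proof.
elim: s => [|[j a] s IH] /=.
  exists 1; last by move=> g; rewrite scale1r !ev_cons !ev_nil.
  by move=> _; rewrite !big_nil.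
case/andP => jp /IH[c c0 e]; have [d d0 f] := refl_gen_gen a jp.
exists (d * c).
  rewrite mulf_eq0 negb_or => /andP[dn0 /c0 cs]; rewrite !big_cons cs /=.
  congr (_ + _); have am : (a <= m j)%N.
    by rewrite leqNgt; apply: contraNN dn0 => /d0->.
  by rewrite /gen_degree deg'p deg'j // mulNrn -addrA -mulrnBr.
by move=> g; rewrite !ev_mul /= f e evZ scalerA.
Qed.

(** A monomial in the reflected generators acts as left multiplication by a
    multiple of an original monomial of the same degree.  A relation among these
    multiples is a relation between operators by [ev_vac_eq0], and then holds in
    the reflected Nichols algebra by [ev_transfer]. *)
Lemma kernel_dim_reflect D : (kernel_dim chi deg' ht' (xiR chi deg' p) p D <=
   kernel_dim chi deg ht (xiL chi deg p) p D)%N.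
Proof.
have /choice[C CP] : forall s, exists c : k, all (fun t => t.1 != p) s ->
  (c != 0 -> \sum_(t <- reflect_index s) gen_degree deg p t.1 t.2 =
            \sum_(t <- s) gen_degree deg' p t.1 t.2) /\
  forall g, ev refl_gen (mon deg' (xiR chi deg' p) p s) g =
     c *: ev X (mon deg (xiL chi deg p) p (reflect_index s)) g.
  move=> s; case: (boolP (all (fun t => t.1 != p) s)) => [/refl_gen_mon[c]|_].
    by exists c.
  by exists 0.
have reflect_indexP s :
    monset deg' p D s -> C s != 0 -> monset deg p D (reflect_index s).
  case=> s1 s2 Cs; have [/(_ Cs) h _] := CP s s1; split; last by rewrite h.
  by rewrite all_map.
pose fam s : A := ev refl_gen (mon deg' (xiR chi deg' p) p s) (vacuum k I).
have step1 : (family_dim fam (monset deg' p D) `|ht D| <=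
    kernel_dim chi deg ht (xiL chi deg p) p D)%N.
  apply: dimvS; apply: hull_min => s ms; rewrite /fam.
  have [_ ->] := CP s ms.1; have [->|Cs] := eqVneq (C s) 0.
    by rewrite scale0r linear0 mem0v.
  by rewrite linearZ_LR memvZ // (hull_gen _ _ (reflect_indexP s ms Cs)).
apply: leq_trans step1; apply: family_dim_le => L LP h.
have homL' := homog_lincomb (xiR chi deg' p) LP.
rewrite comb_vac (refl_gen_transfer homL') ?linear0 // => g.
pose L' := [seq (t.1 * C t.2, reflect_index t.2) | t <- L & C t.2 != 0].
have L'P : {in L', forall t, monset deg p D t.2}.
  move=> t /mapP[u]; rewrite mem_filter => /andP[Cu uL] -> /=.
  by apply: reflect_indexP => //; apply: LP.
have evL g' : ev refl_gen (lincomb deg' (xiR chi deg' p) p L) g' =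
    ev X (lincomb deg (xiL chi deg p) p L') g'.
  rewrite !ev_lincomb /comb big_map big_filter [RHS]big_mkcond /=.
  rewrite big_seq [RHS]big_seq; apply: eq_bigr => t tL.
  have [_ ->] := CP t.2 (LP t tL).1; rewrite scalerA.
  by case: ifPn => //; rewrite negbK => /eqP->; rewrite mulr0 scale0r.
rewrite evL; apply: (ev_vac_eq0 chiP (homog_lincomb (xiL chi deg p) L'P)).
rewrite -evL; apply: (res_inj htD ht_deg (D := D)).
  rewrite evL -[D]addr0; apply: supported_ev; last exact: supported_vac.
  exact: homog_lincomb.
by rewrite -[RHS]h ev_lincomb.
Qed.

End Reflect.

(** * Invariance of the kernel dimensions *)

Section ReflectEq.

Variables (k : fieldType).

Lemma qint_eq0 (q : k) b : qint q b = 0 -> q ^+ b = 1.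
Proof. by move=> h; apply/eqP; rewrite -subr_eq0 subrX1 -/(qint q b) h mulr0. Qed.

Lemma qint_eq0I (q : k) b : q != 1 -> q ^+ b = 1 -> qint q b = 0.
Proof.
move=> q1 qb; apply: (mulfI (x := q - 1)); first by rewrite subr_eq0.
by rewrite mulr0 /qint -subrX1 qb subrr.
Qed.

(** The reflected base has the same [m], so that reflecting twice is the
    identity; the inverted product is the parameter [r] of that base. *)
Lemma refl_cond_inv (q r : k) m : q != 0 -> r != 0 ->
  refl_cond q r m -> refl_cond q (q ^+ m * (q ^+ m * r))^-1 m.
Proof.
move=> q0 r0 [h1 h2 h3]; have qm0 : q ^+ m != 0 by rewrite expf_neq0.
split=> // [a am|].
  rewrite -(inj_eq (mulIf (mulf_neq0 qm0 (mulf_neq0 qm0 r0)))).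
  rewrite mulfVK ?mulf_neq0 // mul1r; apply/negP => /eqP e.
  have {}e : q ^+ (m - a) * (q ^+ m * r) = 1.
    apply: (mulfI (expf_neq0 a q0)).
    by rewrite mulr1 [LHS]mulrA -exprD [(a + _)%N]addnC subnK ?(ltnW am).
  move/eqP: h3; rewrite mulf_eq0 => /orP[/eqP|].
    move=> /qint_eq0 qm1; have/negP[] := h2 (m - a).-1 ltac:(lia).
    rewrite -e mulrA -exprD -[X in X == _]mul1r -qm1 mulrA -exprD.
    by apply/eqP; congr (_ ^+ _ * _); lia.
  rewrite subr_eq0 => /eqP e'; rewrite -e' mulr1 in e.
  have [q1|q1] := eqVneq q 1.
    have/negP[] := h2 0%N ltac:(lia).
    by rewrite expr0 mul1r e' q1 expr1n mul1r.
  by have/negP[] := h1 (m - a)%N ltac:(lia); apply/eqP/qint_eq0I.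
move/eqP: h3; rewrite mulf_eq0 => /orP[/eqP->|]; first by rewrite mul0r.
rewrite subr_eq0 => /eqP e; rewrite -e mulr1 divff // subrr mulr0 //.
Qed.

(** Characteristic zero enters here: for [q = 1] the quantum integers are the
    integers, and none of the positive ones vanishes. *)
Lemma refl_cond_min (q r : k) m : [pchar k] =i pred0 ->
  (q ^+ m * r == 1) || (q ^+ m.+1 == 1) && (q != 1) ->
  (forall a, (q ^+ a * r == 1) || (q ^+ a.+1 == 1) && (q != 1) -> (m <= a)%N) ->
  refl_cond q r m.
Proof.
move=> chark hm hmin; split.
- move=> [//|b] /= bm; apply/negP => /eqP qb.
  have q1 : q != 1.
    apply/eqP => q1; move/eqP: qb; rewrite q1 /qint.
    rewrite (eq_bigr (fun=> 1)) => [|i _]; last by rewrite expr1n.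
    by rewrite sumr_const card_ord; move/pcharf0P: chark => ->.
  have := hmin b; rewrite (qint_eq0 qb) eqxx q1 orbT => /(_ isT); lia.
- move=> a am; apply/negP => e; have := hmin a; rewrite e => /(_ isT); lia.
- case/orP: hm => [/eqP ->|/andP[/eqP e q1]]; first by rewrite subrr mulr0.
  by rewrite (qint_eq0I q1 e) mul0r.
Qed.

Variables (n : nat) (I : finType).
Notation G := ('cV[int]_n).
Variable chi : G -> G -> k.
Hypothesis chiP : bicharacter chi.
Variables (deg deg' : I -> G) (p : I) (m : I -> nat).
Variables (ht ht' : G -> int).
Hypothesis htD : forall a b, ht (a + b) = ht a + ht b.
Hypothesis ht_deg : forall i, ht (deg i) = 1.
Hypothesis ht'D : forall a b, ht' (a + b) = ht' a + ht' b.
Hypothesis ht'_deg : forall i, ht' (deg' i) = 1.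
Hypothesis deg'p : deg' p = - deg p.
Hypothesis deg'j : forall j, j != p -> deg' j = deg j + deg p *+ m j.
Notation q := (chi (deg p) (deg p)).
Notation r j := (chi (deg p) (deg j) * chi (deg j) (deg p)).
Hypothesis refl : forall j, j != p -> refl_cond q (r j) (m j).

(** The inequality [kernel_dim_reflect] applies to the reflection and to its
    inverse, and [kernel_dim_LR] exchanges the two kinds of kernel. *)
Lemma kernel_dim_reflect_eq D :
  kernel_dim chi deg' ht' (xiL chi deg' p) p D =
  kernel_dim chi deg ht (xiL chi deg p) p D.
Proof.
have qE : chi (deg' p) (deg' p) = q.
  by rewrite deg'p bicharNl // bicharNr // invrK.
apply/eqP; rewrite eqn_leq; apply/andP; split.
  rewrite (kernel_dim_LR chiP ht'D ht'_deg).
  exact: (kernel_dim_reflect chiP htD ht_deg ht'D ht'_deg deg'p deg'j refl).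
rewrite (kernel_dim_LR chiP htD ht_deg).
apply: (kernel_dim_reflect chiP ht'D ht'_deg htD ht_deg (m := m)).
- by rewrite deg'p opprK.
- by move=> j jp; rewrite deg'j // deg'p mulNrn addrK.
move=> j jp; rewrite qE.
have -> : chi (deg' p) (deg' j) * chi (deg' j) (deg' p) =
    (q ^+ m j * (q ^+ m j * r j))^-1.
  rewrite deg'p deg'j // bicharNl // bicharNr // -invfM; congr (_^-1).
  by rewrite (bicharDl chiP) (bicharDr chiP) bicharMnl // bicharMnr //; ring.
apply: refl_cond_inv; rewrite ?mulf_neq0 ?(bichar_neq0 chiP) //.
exact: refl.
Qed.

End ReflectEq.

(** * Convolution and logarithmic derivatives *)

Section Convolution.

Variable G : zmodType.

(** Formal series with exponents in a lattice are functions on it.  The sum over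
    the whole lattice makes the product independent of the cone on which the two
    series are supported, which changes under a reflection. *)
Definition conv (a b : G -> int) (d : G) : int :=
  \sum_(e \in [set: G]) a e * b (d - e).

Definition supp_in (M : set G) (a : G -> int) : Prop :=
  forall d, a d != 0 -> M d.

Lemma fsum_seq (s : seq G) (F : G -> int) : uniq s ->
  (forall e, F e != 0 -> e \in s) ->
  \sum_(e \in [set: G]) F e = \sum_(e <- s) F e.
Proof.
move=> us h; rewrite [RHS]fsbig_seq //; apply/esym/fsbig_widen => //= e.
move=> [_ /= es]; apply/eqP/negPn/negP => /h; exact: es.
Qed.

Lemma convC a b : conv a b = conv b a.
Proof.
apply/funext => d; rewrite /conv (reindex_fsbigT (fun e => d - e)).
  by apply: eq_fsbigr => e _; rewrite subKr mulrC.
by exists (fun e => d - e) => e; rewrite subKr.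
Qed.

Lemma sum_neq0 (s : seq G) (F : G -> int) :
  \sum_(e <- s) F e != 0 -> exists2 e, e \in s & F e != 0.
Proof.
move=> h; apply: contrapT => nh; move/eqP: h; apply.
rewrite big_seq big1 // => e es; apply/eqP/negPn/negP => Fe; apply: nh.
by exists e.
Qed.

(** [box N] lists the elements of height at most [N] in a pointed cone; within
    such a cone the convolution is a finite sum. *)
Variables (cone : set G) (ht : G -> int) (box : nat -> seq G).
Hypothesis htD : forall a b, ht (a + b) = ht a + ht b.
Hypothesis cone0 : cone 0.
Hypothesis coneD : forall a b, cone a -> cone b -> cone (a + b).
Hypothesis ht_cone : forall a, cone a -> 0 <= ht a.
Hypothesis ht_cone0 : forall a, cone a -> ht a = 0 -> a = 0.
Hypothesis box_uniq : forall N, uniq (box N).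
Hypothesis boxP : forall N e, e \in box N <-> cone e /\ ht e <= N%:Z.

Lemma convE a b d N : supp_in cone a -> supp_in cone b -> ht d <= N%:Z ->
  conv a b d = \sum_(e <- box N) a e * b (d - e).
Proof.
move=> ha hb dN; apply: fsum_seq => // e; rewrite mulf_eq0 negb_or.
move=> /andP[/ha ce /hb cde]; apply/boxP; split=> //.
have := ht_cone cde; have : ht d = ht e + ht (d - e) by rewrite -htD addrC subrK.
lia.
Qed.

Lemma conv_supp (M : set G) a b : (forall x y, M x -> M y -> M (x + y)) ->
  M `<=` cone -> supp_in M a -> supp_in M b -> supp_in M (conv a b).
Proof.
move=> MD Mc ha hb d.
rewrite (@convE _ _ _ `|ht d|%N); [|by move=> e /ha/Mc|by move=> e /hb/Mc|lia].
move=> /sum_neq0[e _]; rewrite mulf_eq0 negb_or => /andP[/ha ae /hb bde].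
by rewrite -(subrK e d) addrC; apply: MD.
Qed.

Lemma conv_cone a b :
  supp_in cone a -> supp_in cone b -> supp_in cone (conv a b).
Proof. exact: conv_supp. Qed.

Lemma convA a b c : supp_in cone a -> supp_in cone b -> supp_in cone c ->
  conv a (conv b c) = conv (conv a b) c.
Proof.
move=> ha hb hc; apply/funext => d; pose N := `|ht d|%N.
have dN : ht d <= N%:Z by rewrite /N; lia.
rewrite (convE ha (conv_cone hb hc) dN) (convE (conv_cone ha hb) hc dN).
transitivity (\sum_(u <- box N) \sum_(e <- box N) a e * b (u - e) * c (d - u)).
  rewrite exchange_big /= big_seq [RHS]big_seq; apply: eq_bigr => e /boxP[ce _].
  rewrite (eq_bigr (fun u => a e * (b (u - e) * c (d - u)))); last first.
    by move=> u _; rewrite mulrA.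
  rewrite -mulr_sumr; congr (_ * _).
  rewrite -(@fsum_seq (box N) (fun u => b (u - e) * c (d - u))) //; last first.
    move=> u; rewrite mulf_eq0 negb_or => /andP[/hb h1 /hc h2]; apply/boxP.
    have cu : cone u by rewrite -(subrK e u); apply: coneD.
    split=> //; have := ht_cone h2.
    have : ht d = ht u + ht (d - u) by rewrite -htD addrC subrK.
    lia.
  rewrite [RHS](reindex_fsbigT (fun g => g + e)); last first.
    by exists (fun g => g - e) => g; rewrite ?addrK ?subrK.
  apply: eq_fsbigr => g _.
  by rewrite addrK opprD addrCA addrA [- g + d]addrC addrAC.
rewrite big_seq [RHS]big_seq; apply: eq_bigr => u /boxP[_ uN].
by rewrite (convE ha hb uN) mulr_suml.
Qed.

Lemma convDr a b c : supp_in cone a -> supp_in cone b -> supp_in cone c ->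
  conv a (fun d => b d + c d) = (fun d => conv a b d + conv a c d).
Proof.
move=> ha hb hc; apply/funext => d; pose N := `|ht d|%N.
have dN : ht d <= N%:Z by rewrite /N; lia.
rewrite !(convE _ _ dN) //; last first.
  by move=> e; have [->|/hb//] := eqVneq (b e) 0; rewrite add0r => /hc.
by rewrite -big_split; apply: eq_bigr => e _; rewrite mulrDr.
Qed.

Lemma conv_uniq A P Q : supp_in cone A -> supp_in cone P -> supp_in cone Q ->
  A 0 = 1 -> conv A P = conv A Q -> P = Q.
Proof.
move=> hA hP hQ A0 PQ; apply/funext => d.
have [cd|ncd] := pselect (cone d); last first.
  have z (R : G -> int) : supp_in cone R -> R d = 0.
    by move=> hR; apply/eqP/negPn/negP => /hR.
  by rewrite !z.
move e : `|ht d|%N => N; elim/ltn_ind: N => N IH in d cd e *.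
have dN : ht d <= N%:Z by lia.
have := congr1 (fun f => f d) PQ; rewrite /= !(convE _ _ dN) //.
have b0 : 0 \in box N by apply/boxP; rewrite additive0.
rewrite !(bigD1_seq 0) //= A0 subr0 !mul1r.
set s1 := (X in _ + X = _); set s2 := (X in _ = _ + X).
have -> : s1 = s2; last by move/addIr.
rewrite /s1 /s2 big_seq_cond [RHS]big_seq_cond.
apply: eq_bigr => u /andP[/boxP[cu uN] u0].
have [cdu|ncdu] := pselect (cone (d - u)); last first.
  have z (R : G -> int) : supp_in cone R -> R (d - u) = 0.
    by move=> hR; apply/eqP/negPn/negP => /hR.
  by rewrite !z.
congr (_ * _); apply: (IH `|ht (d - u)|%N) => //.
have := ht_cone cdu; have : ht d = ht u + ht (d - u) by rewrite -htD addrC subrK.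
have := ht_cone cu.
have : ht u <> 0 by move/(ht_cone0 cu) => uz; rewrite uz eqxx in u0.
lia.
Qed.

Section Log.

Variable phi : G -> int.
Hypothesis phiD : forall a b, phi (a + b) = phi a + phi b.

(** [P] is the logarithmic derivative of [A] along the linear form [phi]. *)
Definition is_log (A P : G -> int) : Prop :=
  conv A P = (fun d => phi d * A d).

Lemma is_logM A B P Q : supp_in cone A -> supp_in cone B ->
  supp_in cone P -> supp_in cone Q -> is_log A P -> is_log B Q ->
  is_log (conv A B) (fun d => P d + Q d).
Proof.
move=> hA hB hP hQ lA lB; rewrite /is_log convDr //; last exact: conv_cone.
have -> : conv (conv A B) P = conv (fun d => phi d * A d) B.
  by rewrite -convA // [conv B P]convC convA // lA.
have -> : conv (conv A B) Q = conv A (fun d => phi d * B d).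
  by rewrite -convA // lB.
apply/funext => d; pose N := `|ht d|%N.
have dN : ht d <= N%:Z by rewrite /N; lia.
have hp C : supp_in cone C -> supp_in cone (fun d => phi d * C d).
  by move=> hC e; rewrite mulf_eq0 negb_or => /andP[_ /hC].
rewrite !(convE _ _ dN) //; [|exact: hp..].
rewrite -big_split mulr_sumr; apply: eq_bigr => e _ /=.
have -> : phi d = phi e + phi (d - e) by rewrite -phiD addrC subrK.
ring.
Qed.

(** [A 0 = 1] makes the equation solvable by recursion on the height.  The
    solution stays in any submonoid of the cone that contains the support of [A];
    for the kernel series this is the intersection of the cones of two bases. *)
Lemma log_exists (M : set G) A : M 0 -> (forall x y, M x -> M y -> M (x + y)) ->
  M `<=` cone -> supp_in M A -> A 0 = 1 -> exists2 P, supp_in M P & is_log A P.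
Proof.
move=> M0 MD Mc hA A0.
(* A membership test for [d - e] keeps the recursion on elements of smaller
   height: heights outside the cone may be negative. *)
pose step (R : G -> int) (d : G) : int := if `[< M d >] then phi d * A d -
  \sum_(e <- box `|ht d| | (e != 0) && `[< M (d - e) >]) A e * R (d - e) else 0.
pose iterate N := iter N step (fun=> 0).
have small e d : M d -> A e != 0 -> e != 0 -> M (d - e) ->
    (`|ht (d - e)| < `|ht d|)%N.
  move=> Md /hA/Mc ce e0 /Mc cde; have := ht_cone ce; have := ht_cone cde.
  have : ht d = ht e + ht (d - e) by rewrite -htD addrC subrK.
  have : ht e <> 0 by move/(ht_cone0 ce) => uz; rewrite uz eqxx in e0.
  lia.
have stab N N' d :
    (`|ht d| < N)%N -> (`|ht d| < N')%N -> iterate N d = iterate N' d.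
  elim: N N' d => [|N IH] [|N'] d // dN dN'; rewrite /iterate !iterS /step.
  case: asboolP => // Md; congr (_ - _).
  apply: eq_bigr => e /andP[e0 /asboolP cde].
  have [->|Ae] := eqVneq (A e) 0; first by rewrite !mul0r.
  congr (_ * _); have := small e d Md Ae e0 cde => lt.
  by apply: IH; apply: (leq_trans lt); rewrite -ltnS.
pose P d := iterate `|ht d|.+1 d.
have hP : supp_in M P.
  by move=> d; rewrite /P /iterate iterS /step; case: asboolP => //; rewrite eqxx.
exists P => //; apply/funext => d.
have hAc : supp_in cone A by move=> e /hA/Mc.
have hPc : supp_in cone P by move=> e /hP/Mc.
have [Md|nMd] := pselect (M d); last first.
  have z (R : G -> int) : supp_in M R -> R d = 0.
    by move=> hR; apply/eqP/negPn/negP => /hR.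
  by rewrite (z A) // mulr0 z //; apply: conv_supp.
rewrite (@convE _ _ _ `|ht d|%N) //; last by lia.
have b0 : 0 \in box `|ht d| by apply/boxP; rewrite additive0.
rewrite (bigD1_seq 0) //= A0 mul1r subr0 {1}/P /iterate iterS {1}/step.
case: asboolP => // _; rewrite -/(iterate _) -addrA -[RHS]addr0; congr (_ + _).
apply/eqP; rewrite addrC subr_eq0 big_mkcondr; apply/eqP; apply: eq_bigr => e e0.
case: asboolP => [Mde|nMde].
  have [->|Ae] := eqVneq (A e) 0; first by rewrite !mul0r.
  by congr (_ * _); apply: stab => //; apply: small.
suff -> : P (d - e) = 0 by rewrite mulr0.
by apply/eqP/negPn/negP => /hP.
Qed.

Lemma log_at0 A P : supp_in cone A -> supp_in cone P -> A 0 = 1 ->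
  is_log A P -> P 0 = 0.
Proof.
move=> hA hP A0 lA; have h0 := additive0 htD.
have := congr1 (fun f => f 0) lA; rewrite /= A0 mulr1.
have -> : phi 0 = 0 by apply: additive0.
rewrite (@convE _ _ _ 0%N) //; last by rewrite h0.
rewrite (bigD1_seq 0) //=; last by apply/boxP; rewrite h0.
rewrite big_seq_cond big1 ?addr0 ?subr0 ?A0 ?mul1r //.
move=> e /andP[/boxP[ce e0] en0].
have := ht_cone ce => e0'; have ez : ht e = 0 by lia.
by rewrite (ht_cone0 ce ez) eqxx in en0.
Qed.

(** An element of height one has only trivial decompositions in the cone. *)
Lemma log_atom A P g : supp_in cone A -> supp_in cone P -> A 0 = 1 ->
  is_log A P -> ht g = 1 -> P g = phi g * A g.
Proof.
move=> hA hP A0 lA hg; have h0 := additive0 htD.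
have <- := congr1 (fun f => f g) lA.
rewrite (@convE _ _ _ 1%N) //; last by rewrite hg.
rewrite (bigD1_seq 0) //=; last by apply/boxP; rewrite h0.
rewrite A0 mul1r subr0 big_seq_cond big1 ?addr0 // => e /andP[/boxP[ce e1] en0].
have := ht_cone ce => e0'; have [ez|ez] : ht e = 0 \/ ht e = 1 by lia.
  by rewrite (ht_cone0 ce ez) eqxx in en0.
suff -> : P (g - e) = 0 by rewrite mulr0.
apply/eqP/negPn/negP => h; have cge := hP _ h.
have hz : ht (g - e) = 0.
  have : ht g = ht e + ht (g - e) by rewrite -htD addrC subrK.
  by rewrite hg ez; lia.
by move: h; rewrite (ht_cone0 cge hz) (log_at0 hA hP A0 lA) eqxx.
Qed.

End Log.

End Convolution.

(** * The logarithm of the Hilbert series under a reflection *)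

Section Cone.

Variables (n : nat) (I : finType).
Notation G := ('cV[int]_n).
Variables (deg : I -> G) (ht : G -> int).
Hypothesis htD : forall a b, ht (a + b) = ht a + ht b.
Hypothesis ht_deg : forall i, ht (deg i) = 1.

Definition cone : set G := [set d | exists w, d = wdeg deg w].

Definition box (N : nat) : seq G := undup (flatten
  [seq [seq wdeg deg (tval t) | t <- enum {: i.-tuple I}] | i <- iota 0 N.+1]).

Lemma cone0 : cone 0.
Proof. by exists [::]; rewrite wdeg_nil. Qed.

Lemma coneD a b : cone a -> cone b -> cone (a + b).
Proof. by move=> [v ->] [w ->]; exists (v ++ w); rewrite wdeg_cat. Qed.

Lemma cone_deg i : cone (deg i).
Proof. by exists [:: i]; rewrite wdeg_cons wdeg_nil addr0. Qed.

Lemma coneMn a m : cone a -> cone (a *+ m).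
Proof.
by move=> ca; elim: m => [|m IH]; [apply: cone0 | rewrite mulrS; apply: coneD].
Qed.

Lemma ht_cone a : cone a -> 0 <= ht a.
Proof. by move=> [w ->]; rewrite (ht_wdeg htD ht_deg). Qed.

Lemma ht_cone0 a : cone a -> ht a = 0 -> a = 0.
Proof.
move=> [w ->]; rewrite (ht_wdeg htD ht_deg).
by case: w => // _; rewrite wdeg_nil.
Qed.

Lemma box_uniq N : uniq (box N).
Proof. exact: undup_uniq. Qed.

Lemma boxP N e : e \in box N <-> cone e /\ ht e <= N%:Z.
Proof.
rewrite mem_undup; split.
  move=> /flatten_mapP[i]; rewrite mem_iota add0n => /andP[_ iN].
  move=> /mapP[t _ ->]; split; first by exists t.
  by rewrite (ht_wdeg htD ht_deg) size_tuple; lia.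
move=> [[w ->]]; rewrite (ht_wdeg htD ht_deg) => wN.
apply/flatten_mapP; exists (size w); first by rewrite mem_iota; lia.
by apply/mapP; exists (in_tuple w); rewrite // mem_enum.
Qed.

End Cone.

Section HilbertLog.

Variables (k : fieldType) (n : nat) (I : finType).
Notation G := ('cV[int]_n).
Variable chi : G -> G -> k.
Hypothesis chiP : bicharacter chi.
Variable phi : G -> int.
Hypothesis phiD : forall a b, phi (a + b) = phi a + phi b.

Section OneNumbering.

Variables (deg : I -> G) (ht : G -> int).
Hypothesis htD : forall a b, ht (a + b) = ht a + ht b.
Hypothesis ht_deg : forall i, ht (deg i) = 1.
Notation X := (lmul chi deg).

Definition nichols_series (d : G) : int := (nichols_dim chi deg ht d)%:Z.

Lemma nichols_dim_neq0 w : word_op X w (vacuum k I) != 0 ->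
  nichols_dim chi deg ht (wdeg deg w) != 0%N.
Proof.
move=> wn0; apply/eqP => h0; move/eqP: wn0; apply.
apply: (res_inj htD ht_deg (D := wdeg deg w)).
  by rewrite -[wdeg deg w]addr0; apply/supported_word_op/supported_vac.
apply/eqP; rewrite -memv0; move: h0; rewrite /nichols_dim /family_dim => /eqP.
rewrite dimv_eq0 => /eqP <-.
exact: (hull_gen (fun w => word_op X w (vacuum k I))
  (P := [set v | wdeg deg v = wdeg deg w])).
Qed.

Lemma nichols_series0 : nichols_series 0 = 1.
Proof.
have : nichols_dim chi deg ht (wdeg deg [::]) != 0%N.
  apply: nichols_dim_neq0.
  apply/eqP => /(congr1 (fun f : seq I -> k^o => f [::])).
  by rewrite /= /vacuum eqxx => /eqP; rewrite ptE oner_eq0.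
rewrite wdeg_nil /nichols_series => h.
suff : (nichols_dim chi deg ht 0 <= 1)%N by lia.
apply: (@leq_trans (\dim <[res `|ht 0| (vacuum k I)]>)); last first.
  by rewrite dim_vline; case: (_ != 0).
apply: dimvS; apply: hull_min => w /= w0.
by rewrite (pointed_wdeg htD ht_deg w0) memv_line.
Qed.

Lemma nichols_series_deg i : nichols_series (deg i) != 0.
Proof.
have : nichols_dim chi deg ht (wdeg deg [:: i]) != 0%N.
  apply: nichols_dim_neq0.
  apply/eqP => /(congr1 (fun f : seq I -> k^o => lder i f [::])).
  rewrite lder_lmul lder_vac linear0 add0r eqxx scale1r grad_vac //.
  by rewrite linear0 /vacuum eqxx => /eqP; rewrite ptE oner_eq0.
by rewrite wdeg_cons wdeg_nil addr0 /nichols_series => h; lia.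
Qed.

Lemma nichols_series_cone : supp_in (cone deg) nichols_series.
Proof.
move=> d hd; apply: contrapT => nc; move: hd; rewrite /nichols_series.
suff -> : nichols_dim chi deg ht d = 0%N by [].
apply/eqP; rewrite /nichols_dim /family_dim dimv_eq0 -subv0.
by apply: hull_min => w wd; case: nc; exists w.
Qed.

Variable p : I.
Notation q := (chi (deg p) (deg p)).

Definition kernel_series (d : G) : int :=
  (kernel_dim chi deg ht (xiL chi deg p) p d)%:Z.

(** The Hilbert series [1 + t^g + t^(2g) + ...] of the powers of one letter, cut
    off where these powers vanish. *)
Definition string_series (g : G) (c : k) (d : G) : int :=
  (`[< exists2 a, qnonzero c a & d = g *+ a >] : nat)%:Z.

Lemma kernel_series_cone : supp_in (cone deg) kernel_series.
Proof.
move=> d; rewrite /kernel_series => kd.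
apply: (@kernel_dim_neq0 _ _ _ chi deg ht (xiL chi deg p) p).
by move: kd; case: (kernel_dim _ _ _ _ _ _).
Qed.

Lemma string_series_cone :
  supp_in [set deg p *+ a | a in [set: nat]] (string_series (deg p) q).
Proof.
move=> d; rewrite /string_series; case: asboolP => //= -[a _ ->] _; by exists a.
Qed.

Lemma string_series0 g c : string_series g c 0 = 1.
Proof.
rewrite /string_series; case: asboolP => // -[].
exists 0%N; last by rewrite mulr0n.
by move=> b; rewrite leqn0 => /andP[b0 /eqP b00]; rewrite b00 in b0.
Qed.

Lemma nichols_series_conv :
  nichols_series = conv (string_series (deg p) q) kernel_series.
Proof.
have htp a : ht (deg p *+ a) = a%:Z by rewrite (htMn htD) ht_deg natz.
have inj a b : deg p *+ a = deg p *+ b -> a = b.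
  by move/(congr1 ht); rewrite !htp => -[].
apply/funext => d; pose s := [seq deg p *+ a | a <- iota 0 `|ht d|.+1].
rewrite /conv (@fsum_seq _ s); first last.
- move=> e; rewrite mulf_eq0 negb_or.
  move=> /andP[/string_series_cone[a _ <-] /kernel_series_cone cde].
  apply/mapP; exists a => //; rewrite mem_iota add0n ltnS leq0n /=.
  suff : a%:Z <= ht d by lia.
  rewrite -(subrK (deg p *+ a) d) htD htp lerDr.
  exact: (ht_cone htD ht_deg cde).
- by rewrite map_inj_uniq ?iota_uniq.
rewrite /s big_map -[iota 0 _]/(index_iota 0 `|ht d|.+1) big_mkord.
rewrite /nichols_series (nichols_dim_factorL chiP htD ht_deg p) big_mkcond /=.
rewrite (big_morph Posz PoszD (erefl _)); apply: eq_bigr => a _.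
rewrite /string_series /kernel_series; case: (asboolP (qnonzero q a)) => qa.
  case: asboolP => [_|[]]; last by exists a.
  by rewrite mul1r.
case: asboolP => [[b qb /inj ab]|_]; last by rewrite mul0r.
by rewrite ab in qa.
Qed.

Lemma kernel_series0 : kernel_series 0 = 1.
Proof.
have := nichols_dim_factorL chiP htD ht_deg p 0.
have -> : `|ht 0|%N = 0%N by rewrite (ht0 htD).
rewrite (bigD1 ord0) /=; last by apply/asboolP => -[].
rewrite big1 ?addn0 => [|a]; last by rewrite ord1 => /andP[_ /eqP].
rewrite mulr0n subr0 => h; rewrite /kernel_series -h; exact: nichols_series0.
Qed.

End OneNumbering.

Section Reflected.

Variables (deg deg' : I -> G) (p : I) (m : I -> nat) (ht ht' : G -> int).
Hypothesis htD : forall a b, ht (a + b) = ht a + ht b.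
Hypothesis ht_deg : forall i, ht (deg i) = 1.
Hypothesis ht'D : forall a b, ht' (a + b) = ht' a + ht' b.
Hypothesis ht'_deg : forall i, ht' (deg' i) = 1.
Hypothesis deg'p : deg' p = - deg p.
Hypothesis deg'j : forall j, j != p -> deg' j = deg j + deg p *+ m j.
Notation q := (chi (deg p) (deg p)).
Notation r j := (chi (deg p) (deg j) * chi (deg j) (deg p)).
Hypothesis refl : forall j, j != p -> refl_cond q (r j) (m j).

Lemma string_series_opp g c d : string_series (- g) c d = string_series g c (- d).
Proof.
rewrite /string_series; congr (Posz (nat_of_bool _)).
apply/asboolP/asboolP => -[a qa].
  by move=> ->; exists a => //; rewrite mulNrn opprK.
by move=> e; exists a => //; rewrite mulNrn -e opprK.
Qed.

(** The Hilbert series is the product of the string series of [p] and the kernel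
    series.  The logarithm of the kernel series is supported on both cones and is
    common to the two bases; the string series is turned around, and its
    logarithmic derivative changes by [a |-> - w (- a)], which does not affect
    [w a - w (- a)]. *)
Lemma log_reflect P :
  supp_in (cone deg) P -> is_log phi (nichols_series deg ht) P ->
  exists P', [/\ supp_in (cone deg') P', is_log phi (nichols_series deg' ht') P' &
    forall a, P' a - P' (- a) = P a - P (- a)].
Proof.
move=> hP lP.
have phiN a : phi (- a) = - phi a.
  by apply/eqP; rewrite -addr_eq0 -phiD addNr additive0.
have KE : kernel_series deg' ht' p = kernel_series deg ht p.
  apply/funext => d; rewrite /kernel_series.
  by rewrite (kernel_dim_reflect_eq chiP htD ht_deg ht'D ht'_deg deg'p deg'j refl).
have qE : chi (deg' p) (deg' p) = q.
  by rewrite deg'p bicharNl // bicharNr // invrK.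
pose M : set G := cone deg `&` cone deg'.
have [PK hPK lPK] :
    exists2 PK, supp_in M PK & is_log phi (kernel_series deg ht p) PK.
  apply: (log_exists htD (cone0 deg) (ht_cone htD ht_deg) (ht_cone0 htD ht_deg)
    (box_uniq deg) (boxP htD ht_deg) phi (M := M)).
  - by split; apply: cone0.
  - by move=> x y [x1 x2] [y1 y2]; split; apply: coneD.
  - by move=> x [].
  - move=> d Kd; split; first exact: kernel_series_cone Kd.
    by move: Kd; rewrite -KE => /kernel_series_cone.
  - exact: kernel_series0.
pose Np : set G := [set deg p *+ a | a in [set: nat]].
have Np_cone : Np `<=` cone deg by move=> _ [a _ <-]; apply/coneMn/cone_deg.
have [w hw lw] : exists2 w, supp_in Np w & is_log phi (string_series (deg p) q) w.
  apply: (log_exists htD (cone0 deg) (ht_cone htD ht_deg) (ht_cone0 htD ht_deg)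
    (box_uniq deg) (boxP htD ht_deg) phi (M := Np)) => //.
  - by exists 0%N; rewrite ?mulr0n.
  - by move=> _ _ [a _ <-] [b _ <-]; exists (a + b)%N; rewrite ?mulrnDr.
  - exact: string_series_cone.
  - exact: string_series0.
(* Logarithms are unique within the cone of [deg]. *)
have PE : P = fun d => w d + PK d.
  have hsum : supp_in (cone deg) (fun d => w d + PK d).
    move=> d; have [->|/hw/Np_cone//] := eqVneq (w d) 0; rewrite add0r.
    by move=> /hPK[].
  apply: (conv_uniq htD (cone0 deg) (ht_cone htD ht_deg) (ht_cone0 htD ht_deg)
    (box_uniq deg) (boxP htD ht_deg) (A := nichols_series deg ht)) => //.
  - exact: nichols_series_cone.
  - exact: nichols_series0.
  rewrite lP -[RHS]/(conv _ (fun d => w d + PK d)).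
  have : is_log phi (conv (string_series (deg p) q) (kernel_series deg ht p))
      (fun d => w d + PK d).
    apply: (is_logM htD (@coneD _ _ deg) (ht_cone htD ht_deg) 
      (box_uniq deg) (boxP htD ht_deg) phiD) => //.
    + by move=> d /string_series_cone/Np_cone.
    + exact: kernel_series_cone.
    + by move=> d /hw/Np_cone.
    + by move=> d /hPK[].
  by rewrite -nichols_series_conv // => <-.
exists (fun d => - w (- d) + PK d); split.
- move=> d; have [->|wd] := eqVneq (w (- d)) 0.
    by rewrite oppr0 add0r => /hPK[].
  move=> _; have [a _ e] := hw _ wd.
  by rewrite -[d]opprK -e -mulNrn -deg'p; apply/coneMn/cone_deg.
- rewrite (nichols_series_conv ht'D ht'_deg p) qE KE.
  apply: (is_logM ht'D (@coneD _ _ deg') (ht_cone ht'D ht'_deg)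
      (box_uniq deg') (boxP ht'D ht'_deg) phiD).
  + by rewrite -qE => d /string_series_cone[a _ <-]; apply/coneMn/cone_deg.
  + by rewrite -KE; apply: kernel_series_cone.
  + move=> d; rewrite oppr_eq0 => /hw[a _ e].
    by rewrite -[d]opprK -e -mulNrn -deg'p; apply/coneMn/cone_deg.
  + by move=> d /hPK[].
  + apply/funext => d; rewrite deg'p.
    rewrite /conv (reindex_fsbigT (fun e => - e)); last first.
      by exists (fun e => - e) => e; rewrite opprK.
    have L := congr1 (fun f => f (- d)) lw; rewrite /= /conv phiN in L.
    rewrite string_series_opp -[RHS]opprK -mulNr -L -mulN1r mulr_fsumr.
    apply: eq_fsbigr => e _.
    by rewrite string_series_opp !opprK opprD mulN1r mulrN.
  + exact: lPK.
by move=> a; rewrite PE opprK; ring.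
Qed.

End Reflected.

End HilbertLog.

(** * Bases of the lattice *)

Section Bases.

Variable n : nat.
Notation G := ('cV[int]_n).
Implicit Types (F : {fset G}) (T : 'M[int]_n).

(** Coordinates indexed by all vectors, with zero outside the basis, avoid the
    subtype of the elements of [F]. *)
Lemma basis_coord F : is_basis F -> exists c : G -> G -> int,
  [/\ forall f u v, c f (u + v) = c f u + c f v,
      {in F &, forall f g, c f g = (f == g)%:R} &
      forall v, v = \sum_(f <- F) c f v *: f].
Proof.
move=> bF; have /choice[c cP] : forall v : G, exists c : {ffun F -> int},
  v = \sum_(f : F) c f *: val f /\
  forall c' : {ffun F -> int}, v = \sum_(f : F) c' f *: val f -> c = c'.
  by move=> v; have [c [h1 h2]] := bF v; exists c.
have cadd u v : c (u + v) = [ffun f => c u f + c v f].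
  apply: (cP (u + v)).2.
  rewrite {1}(cP u).1 {1}(cP v).1 -big_split; apply: eq_bigr => f _.
  by rewrite ffunE scalerDl.
have cval (g : F) : c (val g) = [ffun f => (f == g)%:R].
  apply: (cP (val g)).2; rewrite (bigD1 g) //= big1 => [|f fg].
    by rewrite ffunE eqxx scale1r addr0.
  by rewrite ffunE (negPf fg) scale0r.
pose c0 f v := if insub f is Some g then c v g else 0.
have c0E (f : F) v : c0 (val f) v = c v f by rewrite /c0 valK.
exists c0; split.
- move=> f u v; rewrite /c0; case: insubP => [g _ _|_]; last by rewrite addr0.
  by rewrite cadd ffunE.
- move=> f g fF gF; rewrite -[f]/(val [` fF]%fset) -[g]/(val [` gF]%fset) c0E.
  by rewrite cval ffunE.
- move=> v; rewrite big_seq_fsetE {1}(cP v).1; apply: eq_bigr => f _.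
  by rewrite c0E.
Qed.

Lemma imP T F v : reflect (exists2 f, f \in F & v = T *m f) (v \in im T F).
Proof. exact: imfsetP. Qed.

Lemma im_mem T F f : f \in F -> T *m f \in im T F.
Proof. by move=> fF; apply/imP; exists f. Qed.

Lemma im1 F : im 1%:M F = F.
Proof.
apply/fsetP => v; apply/imP/idP => [[f fF ->]|vF]; first by rewrite mul1mx.
by exists v; rewrite ?mul1mx.
Qed.

Lemma im_comp T1 T2 F : im (T1 *m T2) F = im T1 (im T2 F).
Proof.
apply/fsetP => v; apply/imP/imP => [[f fF ->]|[_ /imP[f fF ->] ->]].
  by exists (T2 *m f); rewrite ?im_mem // mulmxA.
by exists f; rewrite ?mulmxA.
Qed.

Lemma im_inv T F : T \in unitmx -> im (invmx T) (im T F) = F.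
Proof. by move=> uT; rewrite -im_comp mulVmx // im1. Qed.

Lemma basis_im T F : T \in unitmx -> is_basis F -> is_basis (im T F).
Proof.
move=> uT bF v.
have hP (f : F) : T *m val f \in im T F by apply/im_mem/valP.
have gP (g : im T F) : invmx T *m val g \in F.
  by case/imP: (valP g) => f fF ->; rewrite mulKmx.
pose h (f : F) : im T F := [` hP f]%fset.
pose g (f : im T F) : F := [` gP f]%fset.
have hK : cancel h g by move=> f; apply: val_inj; rewrite /= mulKmx.
have gK : cancel g h by move=> f; apply: val_inj; rewrite /= mulKVmx.
have sumE (c : {ffun im T F -> int}) :
    \sum_(f : im T F) c f *: val f =
    T *m \sum_(f : F) [ffun f => c (h f)] f *: val f.
  rewrite (reindex h); last by exists g => f _; rewrite ?hK ?gK.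
  rewrite mulmx_sumr; apply: eq_bigr => f _.
  by rewrite ffunE -scalemxAr.
have [c [c1 c2]] := bF (invmx T *m v).
have cE : [ffun f : F => [ffun f' : im T F => c (g f')] (h f)] = c.
  by apply/ffunP => f; rewrite !ffunE hK.
exists [ffun f => c (g f)]; split.
  by rewrite sumE cE -c1 mulKVmx.
move=> c' e; apply/ffunP => f; rewrite ffunE (c2 [ffun f => c' (h f)]).
  by rewrite ffunE gK.
by rewrite e sumE mulKmx.
Qed.

Lemma mulmx_ext T1 T2 : (forall v : G, T1 *m v = T2 *m v) -> T1 = T2.
Proof.
move=> h; apply/matrixP => i j.
by have := congr1 (fun v : G => v i 0) (h (delta_mx j 0)); rewrite -!colE !mxE.
Qed.

Lemma basis_neq0 F f : is_basis F -> f \in F -> f != 0.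
Proof.
move=> /basis_coord[c [cD c1 _]] fF; apply/eqP => f0.
have := c1 f f fF fF; rewrite eqxx {2}f0 => e1.
by have := cD f 0 0; rewrite addr0 e1 => /eqP.
Qed.

End Bases.

Lemma scale_Posz (n : nat) (v : 'cV[int]_n) (m : nat) : m%:Z *: v = v *+ m.
Proof. by rewrite -natz scaler_nat. Qed.

(** * Positivity of roots *)

Section WeylBases.

Variables (k : fieldType) (n : nat).
Hypothesis chark : [pchar k] =i pred0.
Notation G := ('cV[int]_n).
Variable chi : G -> G -> k.
Variable E : {fset G}.
Hypothesis chiP : bicharacter chi.
Hypothesis basE : is_basis E.

(** All bases in the Weyl groupoid are indexed by the elements of the initial
    one, so that a reflection keeps the alphabet and changes the degrees. *)
Definition numbering (T : 'M[int]_n) (e : E) : G := T *m val e.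

Lemma height_exists : exists h : G -> int,
  (forall u v, h (u + v) = h u + h v) /\ forall e : E, h (val e) = 1.
Proof.
have [c [cD c1 _]] := basis_coord basE.
exists (fun v => \sum_(f <- E) c f v); split.
  by move=> u v; rewrite -big_split; apply: eq_bigr => f _; rewrite cD.
move=> e; rewrite (big_fsetD1 (val e)) ?(valP e) //= c1 ?(valP e) // eqxx.
rewrite big_seq big1 ?addr0 // => f; rewrite in_fsetD1 => /andP[fe fE].
by rewrite c1 ?(valP e) // (negPf fe).
Qed.

Lemma numbering_height T : T \in unitmx -> exists h : G -> int,
  (forall u v, h (u + v) = h u + h v) /\ forall e, h (numbering T e) = 1.
Proof.
move=> uT; have [h [hD h1]] := height_exists.
exists (fun v => h (invmx T *m v)); split.
  by move=> u v; rewrite mulmxDr hD.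
by move=> e; rewrite /numbering mulKmx.
Qed.

Lemma reflection_unit F f R : is_basis F -> f \in F ->
  is_reflection chi F f R ->
  [/\ R \in unitmx, R *m f = - f &
   exists2 m : G -> nat,
     {in F, forall g, g != f -> R *m g = g + f *+ m g} &
     {in F, forall g, g != f ->
        refl_cond (chi f f) (chi f g * chi g f) (m g)}].
Proof.
move=> bF fF hR.
have Rf : R *m f = - f.
  have [m] := hR f fF; rewrite /m_entry eqxx => -[<-] ->.
  by rewrite scaleNr scale_Posz mulr2n opprD addrA subrr add0r.
have /choice[m mP] : forall g, exists m : nat, g \in F -> g != f ->
    R *m g = g + f *+ m /\ refl_cond (chi f f) (chi f g * chi g f) m.
  move=> g; have [gF|] := boolP (g \in F); last by exists 0%N.
  have [<-|gf] := eqVneq g f; first by exists 0%N.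
  have [m] := hR g gF; rewrite /m_entry (negPf gf).
  case: pselect => // ex [<-] ->; exists (ex_minn ex) => _ _.
  rewrite scale_Posz; split=> //.
  case: ex_minnP => a ha amin; apply: refl_cond_min => //.
    by move: ha; rewrite /m_cond mulrA.
  by move=> b hb; apply: amin; rewrite /m_cond -mulrA.
have [c [_ _ cE]] := basis_coord bF.
have RR : R *m R = 1%:M.
  apply: mulmx_ext => v; rewrite mul1mx (cE v) mulmx_sumr big_seq [RHS]big_seq.
  apply: eq_bigr => g gF; rewrite -scalemxAr; congr (_ *: _).
  rewrite -mulmxA; have [->|gf] := eqVneq g f.
    by rewrite Rf mulmxN Rf opprK.
  have [e _] := mP g gF gf.
  by rewrite e mulmxDr e -scale_Posz -scalemxAr Rf scalerN addrK.
split=> //; first by have [] := mulmx1_unit RR.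
by exists m => g gF gf; have [] := mP g gF gf.
Qed.

Section Invariant.

Variables (phi : G -> int) (L : G -> int).
Hypothesis phiD : forall a b, phi (a + b) = phi a + phi b.

(** [L] does not depend on [F]; the logarithm [P] does. *)
Definition log_base (F : {fset G}) : Prop :=
  exists T (h : G -> int) (P : G -> int),
  [/\ T \in unitmx, F = im T E,
     (forall u v, h (u + v) = h u + h v) /\ (forall e, h (numbering T e) = 1),
     supp_in (cone (numbering T)) P /\
       is_log phi (nichols_series chi (numbering T) h) P &
     forall a, P a - P (- a) = L a].

Lemma log_base_basis F : log_base F -> is_basis F.
Proof. by move=> [T [h [P [uT -> _ _ _]]]]; apply: basis_im. Qed.

Lemma log_base_reflect F f R : log_base F -> f \in F -> is_reflection chi F f R ->
  log_base (im R F).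
Proof.
move=> gF fF hR; have bF := log_base_basis gF.
have [uR Rf [m mR mC]] := reflection_unit bF fF hR.
have [T [h [P [uT FE [hD h1] [sP lP] PL]]]] := gF.
have uRT : R *m T \in unitmx by rewrite unitmx_mul uR.
have [h' [h'D h'1]] := numbering_height uRT.
have [e0 e0E fe] := imP _ _ _ (eq_ind _ (fun X => f \in X) fF _ FE).
pose p : E := [` e0E]%fset.
have degp : numbering T p = f by rewrite fe.
have degF (j : E) : numbering T j \in F by rewrite FE im_mem ?(valP j).
have degne (j : E) : j != p -> numbering T j != f.
  apply: contraNN; rewrite -degp => /eqP /(congr1 (mulmx (invmx T))).
  by rewrite /numbering !mulKmx // => /val_inj->.
have nRT (j : E) : numbering (R *m T) j = R *m numbering T j.
  by rewrite /numbering mulmxA.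
have [|||P' [sP' lP' PP']] := @log_reflect k n E chi chiP phi phiD
  (numbering T) (numbering (R *m T)) p (fun j => m (numbering T j)) h h'
  hD h1 h'D h'1 _ _ _ P sP lP.
- by rewrite nRT degp.
- by move=> j jp; rewrite nRT degp mR // degne.
- by move=> j jp; rewrite degp; apply: mC => //; apply: degne.
exists (R *m T), h', P'; split=> //; first by rewrite FE im_comp.
by move=> a; rewrite PP'.
Qed.

(** The arrows between bases with this property form a subgroupoid closed under
    reflections. *)
Lemma log_base_weyl :
  log_base E -> forall F, weyl_groupoid chi E (1%:M, F) -> log_base F.
Proof.
move=> gE F wF.
pose W0 : set ('M[int]_n * {fset G}) :=
  [set p | [/\ p.1 \in unitmx, log_base p.2 & log_base (im p.1 p.2)]].
suff : W0 (1%:M, F) by case.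
apply: wF; split; last first.
  by move=> _ ->; rewrite /W0 /= unitmx1 im1.
split; last first.
  move=> F' f R [_ gF' _] fF' hR.
  have [uR _ _] := reflection_unit (log_base_basis gF') fF' hR.
  have gR := log_base_reflect gF' fF' hR.
  by split; split=> //=; rewrite ?unitmx1 ?im1.
split.
- by move=> [T F'] [uT gF' _]; split=> //; apply: log_base_basis.
- move=> T1 F1 T2 F2 [/= u1 g1 g1'] [/= u2 g2 g2'] e; split=> //=.
    by rewrite unitmx_mul u1 u2.
  by rewrite im_comp e.
- move=> T F' [/= uT gF' gF'']; split=> //=; first by rewrite unitmx_inv.
  by rewrite im_inv.
Qed.

End Invariant.

Lemma log_base_initial phi : exists L, log_base phi L E.
Proof.
have [h [hD h1]] := numbering_height (unitmx1 _ n).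
have := log_exists hD (cone0 _) (ht_cone hD h1) (ht_cone0 hD h1)
  (box_uniq (numbering 1%:M)) (boxP hD h1) phi (M := cone (numbering 1%:M))
  (A := nichols_series chi (numbering 1%:M) h).
case=> //.
- exact: cone0.
- by move=> x y; apply: coneD.
- exact: nichols_series_cone.
- exact: nichols_series0.
move=> P sP lP; exists (fun a => P a - P (- a)); exists 1%:M, h, P.
by split; rewrite ?unitmx1 ?im1.
Qed.

Definition pcone (F : {fset G}) (v : G) : Prop :=
  exists2 s : seq G, {subset s <= F} & v = \sum_(x <- s) x.

Lemma cone_pcone T v : cone (numbering T) v -> pcone (im T E) v.
Proof.
move=> [w ->]; exists [seq numbering T e | e <- w].
  by move=> _ /mapP[e _ ->]; apply/im_mem/valP.
by rewrite big_map.
Qed.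

(** With [phi] a coordinate that does not vanish at [b], the logarithm for [F1]
    is nonzero at [b] and zero at [- b], so the invariant is nonzero at [b].
    Hence the logarithm for [F2] is nonzero at [b] or at [- b], and it is
    supported on the cone of [F2]. *)
Theorem root_sign F1 F2 b :
  weyl_groupoid chi E (1%:M, F1) -> weyl_groupoid chi E (1%:M, F2) ->
  b \in F1 -> pcone F2 b \/ pcone F2 (- b).
Proof.
move=> w1 w2 bF1.
pose ph (i : 'I_n) (v : G) : int := v i 0.
have phD i u v : ph i (u + v) = ph i u + ph i v by rewrite /ph mxE.
have bas1 : is_basis F1.
  have [L gE] := log_base_initial (fun=> 0).
  by apply: (log_base_basis (log_base_weyl _ gE w1)) => *; rewrite addr0.
have [i bi] : exists i, b i 0 != 0.
  apply: contrapT => nb; move/eqP: (basis_neq0 bas1 bF1); apply.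
  apply/colP => i; rewrite mxE; apply/eqP/negPn/negP => bi.
  by apply: nb; exists i.
have [L gE] := log_base_initial (ph i).
have [T1 [h1 [P1 [u1 E1 [h1D h1d] [s1 l1] L1]]]] := log_base_weyl (phD i) gE w1.
have [T2 [h2 [P2 [u2 E2 [h2D h2d] [s2 l2] L2]]]] := log_base_weyl (phD i) gE w2.
have [e eE be] := imP _ _ _ (eq_ind _ (fun X => b \in X) bF1 _ E1).
have bE : b = numbering T1 [` eE]%fset by rewrite be.
have P1b : P1 b != 0.
  rewrite bE (log_atom h1D (cone0 _) (ht_cone h1D h1d) (ht_cone0 h1D h1d)
    (box_uniq (numbering T1)) (boxP h1D h1d) (phD i) _ s1 _ l1 (h1d _)) //.
  - by rewrite mulf_neq0 ?nichols_series_deg // -bE.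
  - exact: nichols_series_cone.
  - exact: nichols_series0.
have P1Nb : P1 (- b) = 0.
  apply/eqP/negPn/negP => /s1 /(ht_cone h1D h1d).
  have := h1D b (- b); rewrite subrr (ht0 h1D) bE h1d; lia.
have : L b != 0 by rewrite -L1 P1Nb subr0.
rewrite -L2; have [P2b|/s2 c2 _] := eqVneq (P2 b) 0; last first.
  by left; rewrite E2; apply: cone_pcone.
rewrite P2b sub0r oppr_eq0 => /s2 c2.
by right; rewrite E2; apply: cone_pcone.
Qed.

End WeylBases.

(** * Chambers *)

Section Chambers.

Variables (k : fieldType) (n : nat).
Hypothesis chark : [pchar k] =i pred0.
Notation G := ('cV[int]_n).
Variables (Delta : set G) (chi : G -> G -> k) (E : {fset G}).
Hypothesis ars : arithmetic_root_system Delta chi E.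

Definition weyl_base (F : {fset G}) : Prop := weyl_groupoid chi E (1%:M, F).

Let chiP : bicharacter chi := ars_bichar ars.
Let basE : is_basis E := ars_basis ars.

Lemma weyl_base_basis F : weyl_base F -> is_basis F.
Proof.
move=> wF; have [L gE] := log_base_initial chi basE (fun=> 0).
apply: (log_base_basis basE (log_base_weyl chark chiP basE _ gE wF)) => *.
by rewrite addr0.
Qed.

Lemma weyl_base_root F f : weyl_base F -> f \in F -> Delta f.
Proof. by move=> wF fF; rewrite (ars_roots ars); exists F. Qed.

Lemma root_weyl_base b : Delta b -> exists2 F, weyl_base F & b \in F.
Proof. by rewrite (ars_roots ars) => -[F wF bF]; exists F. Qed.

Lemma weyl_base_reflect F f : weyl_base F -> f \in F -> exists R (m : G -> nat),
  [/\ weyl_base (im R F), R *m f = - f &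
      {in F, forall g, g != f -> R *m g = g + f *+ m g}].
Proof.
move=> wF fF; have [R hR] := ars_full ars wF fF.
have [_ Rf [m mR _]] := reflection_unit chark (weyl_base_basis wF) fF hR.
exists R, m; split=> // W [[sW rW] EW].
by have [_ wR] := rW F f R (wF W (conj (conj sW rW) EW)) fF hR; apply: wR.
Qed.

Lemma root_opp b : Delta b -> Delta (- b).
Proof.
move=> /root_weyl_base[F wF bF].
have [R [m [wR Rf _]]] := weyl_base_reflect wF bF.
by apply: (weyl_base_root wR); rewrite -Rf im_mem.
Qed.

Lemma root_pcone F b : weyl_base F -> Delta b -> pcone F b \/ pcone F (- b).
Proof.
by move=> wF /root_weyl_base[F1 w1 b1]; apply: (root_sign chark chiP basE w1).
Qed.

Lemma root_neq0 b : Delta b -> b != 0.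
Proof. by move=> /root_weyl_base[F /weyl_base_basis bF]; apply: basis_neq0. Qed.

Lemma additive_sum (c : G -> int) (s : seq G) :
  (forall u v, c (u + v) = c u + c v) -> c (\sum_(x <- s) x) = \sum_(x <- s) c x.
Proof.
by move=> cD; apply: (big_morph c cD (additive0 cD)).
Qed.

Lemma additive_scale (c : G -> int) (z : int) v :
  (forall u v, c (u + v) = c u + c v) -> c (z *: v) = z * c v.
Proof.
move=> cD; have c0 := additive0 cD.
have cN u : c (- u) = - c u by apply: (addrI (c u)); rewrite -cD !subrr.
have cM m u : c (u *+ m) = c u *+ m.
  by elim: m => [|m IH]; rewrite ?mulr0n // !mulrS cD IH.
case: z => m; first by rewrite scale_Posz cM -mulr_natl natz.
by rewrite NegzE scaleNr scale_Posz cN cM mulNr -mulr_natl natz.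
Qed.

Lemma pcone_ge0 F c v : (forall u v : G, c (u + v) = c u + c v) ->
  {in F, forall f : G, 0 <= c f} -> pcone F v -> (0 : int) <= c v.
Proof.
move=> cD cF [s sF ->]; rewrite additive_sum // big_seq sumr_ge0 // => x /sF.
exact: cF.
Qed.

(** A root is a member of a basis of the lattice. *)
Lemma root_primitive b x (a : nat) : Delta b -> b = x *+ a -> a = 1%N.
Proof.
move=> /root_weyl_base[F /weyl_base_basis/basis_coord[c [cD c1 _]] bF] e.
have := c1 b b bF bF; rewrite eqxx {2}e -scale_Posz additive_scale //=.
move=> h; have : (a%:Z %| 1)%Z by apply/dvdzP; exists (c b x); rewrite mulrC h.
by rewrite dvdzE absz1 dvdn1 => /eqP.
Qed.

Lemma pcone_antisym (F : {fset G}) v :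
  is_basis F -> pcone F v -> pcone F (- v) -> v = 0.
Proof.
move=> /basis_coord[c [cD c1 cE]] p1 p2; rewrite (cE v) big_seq big1 // => f fF.
have cF : {in F, forall g, 0 <= c f g} by move=> g gF; rewrite c1.
have h1 := pcone_ge0 (cD f) cF p1; have := pcone_ge0 (cD f) cF p2.
rewrite -scaleN1r additive_scale // => h2.
have -> : c f v = 0 by lia.
exact: scale0r.
Qed.

Lemma pcone_mem (F : {fset G}) f : f \in F -> pcone F f.
Proof.
by move=> fF; exists [:: f]; rewrite ?big_seq1 // => x; rewrite inE => /eqP->.
Qed.

(** A positive root other than [f] has a positive coordinate at some [g != f],
    and the reflection does not change that coordinate. *)
Lemma pcone_reflect F f R (m : G -> nat) b :
  weyl_base F -> weyl_base (im R F) -> f \in F -> R *m f = - f ->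
  {in F, forall g, g != f -> R *m g = g + f *+ m g} ->
  Delta b -> b != f -> pcone F b -> pcone (im R F) b.
Proof.
move=> wF wR fF Rf Rm Db bf pb; case: (root_pcone wR Db) => // pNb.
have [c [cD c1 cE]] := basis_coord (weyl_base_basis wF).
have cF g : g \in F -> 0 <= c g b.
  by move=> gF; apply: (pcone_ge0 (cD g) _ pb) => h hF; rewrite c1.
have cz g : g \in F -> g != f -> c g b = 0.
  move=> gF gf; have := cF g gF.
  have : 0 <= c g (- b).
    apply: (pcone_ge0 (cD g) _ pNb) => _ /imP[h hF ->].
    have [->|hf] := eqVneq h f.
      by rewrite Rf -scaleN1r additive_scale // c1 // (negPf gf) mulr0.
    rewrite Rm // cD -scale_Posz additive_scale // !c1 // (negPf gf) mulr0 addr0.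
    by [].
  by rewrite -scaleN1r additive_scale //; lia.
have be : b = f *+ `|c f b|%N.
  rewrite {1}(cE b) (big_fsetD1 f) //= big_seq big1 ?addr0.
    by rewrite -scale_Posz gez0_abs // cF.
  by move=> g; rewrite in_fsetD1 => /andP[gf gF]; rewrite cz // scale0r.
by move: bf; rewrite be (root_primitive Db be) mulr1n eqxx.
Qed.

Lemma root_finite : finite_set Delta.
Proof.
rewrite (ars_roots ars); apply: bigcup_finite.
  apply: (@sub_finite_set _ _ (snd @` weyl_groupoid chi E)).
    by move=> F wF; exists (1%:M, F).
  exact/finite_image/(ars_finite ars).
by move=> F _; apply: finite_fset.
Qed.

Lemma weyl_base_E : weyl_base E.
Proof. by move=> W [_ EW]; apply: EW. Qed.

(** If [f] in [F] is not chosen, the reflected base has the same positive roots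
    except that [- f], a chosen root, replaces [f]. *)
Theorem chamber_exists (pos : G -> Prop) :
  (forall b, Delta b -> pos b \/ pos (- b)) ->
  exists2 F, weyl_base F & {in F, forall f, pos f}.
Proof.
move=> posD.
pose neg F : set G := Delta `&` [set b | pcone F b /\ ~ pos b].
have fin F : finite_set (neg F).
  by apply: (sub_finite_set _ root_finite) => b [].
pose pr d := `[< exists2 F, weyl_base F & #|` fset_set (neg F)| = d >].
have ex0 : exists d, pr d.
  exists #|` fset_set (neg E)|; apply/asboolP.
  by exists E => //; apply: weyl_base_E.
case: (ex_minnP ex0) => d /asboolP[F wF Fd] dmin.
exists F => // f fF; apply: contrapT => nf.
have Df := weyl_base_root wF fF.
have [R [m [wR Rf Rm]]] := weyl_base_reflect wF fF.
have := dmin #|` fset_set (neg (im R F))|.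
rewrite leqNgt => /(_ (asboolT _))/negP; apply; first by exists (im R F).
rewrite -Fd; apply: fproper_ltn_card; rewrite fproperE.
apply/andP; split.
  apply/fsubsetP => b; rewrite !in_fset_set // => /set_mem[Db [pb nb]].
  apply/mem_set; split=> //; split=> //; case: (root_pcone wF Db) => // pNb.
  have bf : - b != f.
    by apply/eqP => e; case: (posD f Df) => //; rewrite -e opprK.
  have := pcone_reflect wF wR fF Rf Rm (root_opp Db) bf pNb.
  move/(pcone_antisym (weyl_base_basis wR) pb) => b0.
  by have := root_neq0 Db; rewrite b0 eqxx.
apply/fsubsetPn; exists f; rewrite in_fset_set //.
  by apply/mem_set; split=> //; split=> //; apply: pcone_mem.
apply/negP => /set_mem[_ [pf _]].
have pNf : pcone (im R F) (- f) by apply: pcone_mem; rewrite -Rf im_mem.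
have := pcone_antisym (weyl_base_basis wR) pf pNf => f0.
by have := root_neq0 Df; rewrite f0 eqxx.
Qed.

End Chambers.

(** * Lexicographic order adapted to the family *)

Section RealCoordinates.

Variables (R : realType) (n : nat).
Notation G := ('cV[int]_n).
Notation V := ('cV[R]_n).

Lemma to_realB (u v : G) : to_real R (u - v) = to_real R u - to_real R v.
Proof. exact: raddfB. Qed.

Lemma to_realN (u : G) : to_real R (- u) = - to_real R u.
Proof. exact: raddfN. Qed.

Lemma to_realMn (u : G) m : to_real R (u *+ m) = m%:R *: to_real R u.
Proof. by rewrite /to_real raddfMn scaler_nat. Qed.

Lemma to_real_sum (J : Type) (s : seq J) (P : pred J) (F : J -> G) :
  to_real R (\sum_(j <- s | P j) F j) = \sum_(j <- s | P j) to_real R (F j).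
Proof. exact: raddf_sum. Qed.

Lemma to_real_inj : injective (@to_real R n).
Proof.
move=> u v e; apply/colP => i.
by have := congr1 (fun w : V => w i 0) e; rewrite !mxE => /intr_inj.
Qed.

Lemma real_extension (c : G -> int) : (forall u v, c (u + v) = c u + c v) ->
  exists g : {linear V -> R^o}, forall w, g (to_real R w) = (c w)%:~R.
Proof.
move=> cD.
pose g (v : V) : R^o := \sum_(i < n) v i 0 * (c (delta_mx i 0))%:~R.
have g_lin : linear g.
  move=> a u v; rewrite /g scaler_sumr -big_split; apply: eq_bigr => i _.
  by rewrite !mxE mulrDl -mulrA.
pose gM := GRing.isLinear.Build R V R^o *:%R g g_lin.
pose gL : {linear V -> R^o} := HB.pack g gM.
exists gL => w; rewrite /= /g.
have -> : c w = \sum_(i < n) w i 0 * c (delta_mx i 0).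
  rewrite {1}(matrix_sum_delta w).
  rewrite (big_morph c cD (additive0 cD)).
  by apply: eq_bigr => i _; rewrite big_ord1 additive_scale.
rewrite rmorph_sum; apply: eq_bigr => i _.
by rewrite rmorphM /= mxE.
Qed.

Variables (l : nat) (f : 'I_l -> G).
Hypothesis f_free : free (real_family R f).

Lemma real_familyE (i : 'I_l) : (real_family R f)`_i = to_real R (f i).
Proof. by rewrite -(tnth_nth 0 (real_family R f) i) tnth_mktuple. Qed.

Definition codim : nat := \dim (<<real_family R f>>^C)%VS.

(** The family comes last, so that its span, and the span of each of its final
    segments, is defined by the vanishing of initial coordinates. *)
Definition adapted_basis : (codim + l).-tuple V :=
  [tuple of vbasis (<<real_family R f>>^C)%VS ++ real_family R f].

Lemma adapted_basisP : basis_of fullv adapted_basis.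
Proof.
rewrite /basis_of span_cat; apply/andP; split.
  by rewrite (span_basis (vbasisP _)) addvC addv_complf.
rewrite cat_free f_free (basis_free (vbasisP _)) /=.
by apply/directv_addP; rewrite (span_basis (vbasisP _)) capvC capv_compl.
Qed.

Notation u j v := (coord adapted_basis j v).

Lemma adapted_basis_r (i : 'I_l) :
  adapted_basis`_(rshift codim i) = to_real R (f i).
Proof.
by rewrite nth_cat size_tuple /= ltnNge leq_addr /= addKn real_familyE.
Qed.

Lemma coord_f (j : 'I_(codim + l)) (i : 'I_l) :
  u j (to_real R (f i)) = (j == rshift codim i)%:R.
Proof.
by rewrite -adapted_basis_r coord_free ?(basis_free adapted_basisP) // eq_sym.
Qed.

Lemma coord_eq v : v = \sum_j u j v *: adapted_basis`_j.
Proof. by apply: coord_span; rewrite (span_basis adapted_basisP) memvf. Qed.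

Lemma coord_span0 (j : 'I_(codim + l)) v :
  v \in <<real_family R f>>%VS -> (j < codim)%N -> u j v = 0.
Proof.
move=> /coord_span -> jc; rewrite linear_sum big1 // => i _.
rewrite linearZ_LR /= real_familyE coord_f.
case: eqVneq => [e|_]; last by rewrite mulr0.
by move: jc; rewrite e /= ltnNge leq_addr.
Qed.

Definition vanish (s : nat) (v : V) : Prop :=
  forall j : 'I_(codim + l), (j < s)%N -> u j v = 0.

Lemma vanish_span t v : vanish (codim + t) v ->
  v = \sum_(i < l | (t <= i)%N) u (rshift codim i) v *: to_real R (f i).
Proof.
move=> h; rewrite {1}(coord_eq v) big_split_ord /= big1 ?add0r => [|j _].
  rewrite [RHS]big_mkcond; apply: eq_bigr => i _ /=; rewrite adapted_basis_r.
  by case: leqP => // it; rewrite h ?scale0r //= ltn_add2l.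
by rewrite h ?scale0r //= (leq_trans (ltn_ord j)) ?leq_addr.
Qed.

Definition lexpos (v : V) : Prop :=
  exists2 j : 'I_(codim + l), 0 < u j v & vanish j v.

Lemma lexpos_total v : v != 0 -> lexpos v \/ lexpos (- v).
Proof.
move=> v0; have [j0 uj0] : exists j, u j v != 0.
  apply: contrapT => nh; move/eqP: v0; apply; rewrite (coord_eq v) big1 // => j _.
  suff -> : u j v = 0 by rewrite scale0r.
  by apply/eqP/negPn/negP => uj; apply: nh; exists j.
case: (@arg_minnP _ j0 (fun j => u j v != 0) (fun j => val j) uj0) => j uj jmin.
have vj : vanish j v.
  move=> i ij; apply/eqP/negPn/negP => /jmin; rewrite leqNgt.
  by rewrite ij.
have [lt|le] := ltP 0 (u j v); first by left; exists j.
right; exists j; first by rewrite linearN oppr_gt0 lt_neqAle uj le.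
by move=> i ij; rewrite linearN /= vj // oppr0.
Qed.

Lemma lexpos_vanish v (j : 'I_(codim + l)) : lexpos v -> vanish j v -> 0 <= u j v.
Proof.
move=> [i ui vi] vj; have [ij|ji|e] := ltngtP i j.
- by move: ui; rewrite vj // ltxx.
- by rewrite vi.
by rewrite -(val_inj e) ltW.
Qed.

Lemma vanish0_eq0 v : vanish (codim + l) v -> v = 0.
Proof.
move=> h; rewrite (coord_eq v) big1 // => j _.
by rewrite h ?scale0r.
Qed.

End RealCoordinates.

(** * The base of a lexicographic chamber *)

Section LexBase.

Variables (R : realType) (k : fieldType) (n : nat).
Hypothesis chark : [pchar k] =i pred0.
Notation G := ('cV[int]_n).
Notation V := ('cV[R]_n).
Variables (Delta : set G) (chi : G -> G -> k) (E : {fset G}).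
Hypothesis ars : arithmetic_root_system Delta chi E.
Variables (l : nat) (f : 'I_l -> G).
Hypothesis f_Delta : forall i, Delta (f i).
Hypothesis f_free : free (real_family R f).
Notation u j v := (coord (adapted_basis R f) j (to_real R v)).
Notation N := (codim R f).

Variable F : {fset G}.
Hypothesis wF : weyl_base chi E F.
Hypothesis Fpos : {in F, forall g, lexpos f (to_real R g)}.

Variable c : G -> G -> int.
Hypothesis cD : forall g v w, c g (v + w) = c g v + c g w.
Hypothesis c1 : {in F &, forall g h, c g h = (g == h)%:R}.
Hypothesis cE : forall v, v = \sum_(g <- F) c g v *: g.

Lemma coord_pcone g v : g \in F -> pcone F v -> 0 <= c g v.
Proof. by move=> gF; apply: (pcone_ge0 (cD g)) => h hF; rewrite c1. Qed.

Lemma to_real_coord v :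
  to_real R v = \sum_(g <- F) (c g v)%:~R *: to_real R g.
Proof.
rewrite {1}(cE v) to_real_sum; apply: eq_bigr => g _.
by apply/colP => i; rewrite !mxE rmorphM.
Qed.

(** The first coordinate in which some summand does not vanish is nonnegative in
    all summands, so it would survive in the sum. *)
Lemma support_vanish s v : pcone F v -> vanish f s (to_real R v) ->
  {in F, forall g, c g v != 0 -> vanish f s (to_real R g)}.
Proof.
move=> pv vs g gF cg j js.
elim/ltn_ind: {j}(val j) {-2}j (erefl (val j)) js g gF cg => a IH j ja js g gF cg.
have vj h : h \in F -> c h v != 0 -> vanish f j (to_real R h).
  move=> hF ch i ij; apply: (IH (val i)) => //; first by rewrite -ja.
  exact: ltn_trans ij js.
have := vs j js; rewrite to_real_coord linear_sum big_seq => /eqP.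
rewrite psumr_eq0 => [|h hF]; last first.
  rewrite linearZ_LR /=; have [->|ch] := eqVneq (c h v) 0; first by rewrite mul0r.
  rewrite mulr_ge0 ?ler0z ?(coord_pcone hF pv) //.
  by apply: lexpos_vanish; [apply: Fpos | apply: vj].
move=> /allP/(_ g gF); rewrite gF linearZ_LR /= mulf_eq0 intr_eq0 (negPf cg) /=.
by move/eqP.
Qed.

Hypothesis no_multiple : forall (i : 'I_l) (m : 'I_l -> nat), (i.+1 < l)%N ->
  (exists2 j : 'I_l, (i < j)%N & m j <> 0%N) ->
  ~ pos_multiples Delta (f i - \sum_(j < l | (i < j)%N) f j *+ m j).

Lemma f_inj : injective f.
Proof.
move=> i j e; have := coord_f f_free (rshift N i) i; rewrite eqxx e coord_f //.
case: (eqVneq (rshift N i) (rshift N j)) => [/rshift_inj//|_] /eqP.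
by rewrite eq_sym oner_eq0.
Qed.

Lemma coord_ge0 j v : pcone F v ->
  {in F, forall g, c g v != 0 -> 0 <= u j g} -> 0 <= u j v.
Proof.
move=> pv h; rewrite to_real_coord linear_sum big_seq sumr_ge0 // => g gF.
rewrite linearZ_LR /=; have [->|cg] := eqVneq (c g v) 0; first by rewrite mul0r.
by rewrite mulr_ge0 ?ler0z ?(coord_pcone gF pv) // h.
Qed.

Lemma vanish_f (i : 'I_l) : vanish f (N + i) (to_real R (f i)).
Proof.
move=> j ji; rewrite coord_f //; case: eqVneq => // e.
by move: ji; rewrite e /= ltnn.
Qed.

Lemma coordN j v : u j (- v) = - u j v.
Proof. by rewrite to_realN linearN. Qed.

Lemma pcone_f (i : 'I_l) : pcone F (f i).
Proof.
have [//|pN] := root_pcone chark ars wF (f_Delta i).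
have : 0 <= u (rshift N i) (- f i).
  apply: (coord_ge0 pN) => g gF cg; apply: lexpos_vanish; first exact: Fpos.
  apply: (support_vanish pN _ gF cg) => j ji.
  by rewrite coordN vanish_f ?oppr0.
by rewrite coordN coord_f // eqxx oppr_ge0 ler10.
Qed.

(** Any two elements of [F] that lie in the span of [f_t, f_(t+1), ...] but not
    in that of [f_(t+1), ...] satisfy a real linear relation with elements of
    [F], as the two spans differ by one dimension; so there is only one such
    element [x]. *)
Lemma simple_step (t : 'I_l) :
  (forall i : 'I_l, (t < i)%N -> f i \in F) ->
  {in F, forall g, vanish f (N + t.+1) (to_real R g) ->
     exists2 i : 'I_l, (t < i)%N & g = f i} ->
  f t \in F /\
  {in F, forall g, vanish f (N + t) (to_real R g) ->
     exists2 i : 'I_l, (t <= i)%N & g = f i}.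
Proof.
move=> fF Fv; pose jt : 'I_(N + l) := rshift N t.
have vS g : vanish f (N + t) (to_real R g) -> u jt g = 0 ->
    vanish f (N + t.+1) (to_real R g).
  move=> vg ug j; rewrite addnS ltnS leq_eqVlt => /orP[/eqP e|]; last exact: vg.
  by rewrite (_ : j = jt) //; apply: val_inj.
have pf := pcone_f t.
have supp g : g \in F -> c g (f t) != 0 -> vanish f (N + t) (to_real R g).
  by move=> gF cg; apply: (support_vanish pf _ gF cg); apply: vanish_f.
have [x [xF cx ux]] : exists x, [/\ x \in F, c x (f t) != 0 & u jt x != 0].
  apply: contrapT => nx; have : u jt (f t) = 1 by rewrite coord_f // eqxx.
  rewrite to_real_coord linear_sum big_seq big1 => [/eqP|g gF].
    by rewrite eq_sym oner_eq0.
  rewrite linearZ_LR /=; have [->|cg] := eqVneq (c g (f t)) 0.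
    by rewrite mul0r.
  suff -> : u jt g = 0 by rewrite mulr0.
  by apply/eqP/negPn/negP => ug; apply: nx; exists g.
have vx := supp x xF cx.
have nfx (i : 'I_l) : (t < i)%N -> f i != x.
  move=> ti; apply: contraNN ux => /eqP <-; rewrite coord_f //.
  case: (eqVneq jt (rshift N i)) => [/rshift_inj e|_]; last by rewrite eqxx.
  by rewrite e ltnn in ti.
(* The integral coordinate at [g] extends to a real linear form, which is
   applied to the combination of [x] and [g] without [t]-th coordinate. *)
have uniq_x g : g \in F -> vanish f (N + t) (to_real R g) -> u jt g != 0 -> g = x.
  move=> gF vg ug; apply/eqP/negPn/negP => gx.
  have [cR cRE] := real_extension R (cD g).
  pose v := u jt x *: to_real R g - u jt g *: to_real R x.
  have vv : vanish f (N + t.+1) v.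
    move=> j; rewrite addnS ltnS leq_eqVlt /v linearB !linearZ_LR /=.
    move=> /orP[/eqP e|js].
      have -> : j = jt by apply: val_inj.
      by apply/eqP; rewrite subr_eq0 mulrC.
    by rewrite (vx j js) (vg j js) !mulr0 subr0.
  have := congr1 cR (vanish_span f_free vv).
  rewrite linear_sum big1 => [|i ti]; last first.
    rewrite linearZ_LR /= cRE c1 ?fF //.
    have [e|_] := eqVneq g (f i); last by rewrite scaler0.
    move: ug; rewrite e coord_f //.
    case: (eqVneq jt (rshift N i)) => [/rshift_inj e'|_]; last by rewrite eqxx.
    by rewrite e' ltnn in ti.
  rewrite /v linearB !linearZ_LR /= !cRE !c1 // eqxx (negPf gx).
  rewrite mulr0z mulr1z oppr0 scaler0 addr0 => /eqP.
  by rewrite scaler_eq0 (negPf ux) oner_eq0.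
pose m (j : 'I_l) : nat := `|c (f j) (f t)|%N.
have mE (j : 'I_l) : (t < j)%N -> c (f j) (f t) = (m j)%:Z.
  by move=> tj; rewrite /m gez0_abs // (coord_pcone (fF j tj) pf).
pose a := `|c x (f t)|%N.
have aE : c x (f t) = a%:Z by rewrite /a gez0_abs // (coord_pcone xF pf).
(* Both sides have the same coordinates in [F]. *)
have decomp : f t - \sum_(j < l | (t < j)%N) f j *+ m j = x *+ a.
  apply/eqP; rewrite -subr_eq0; set w := _ - _; apply/eqP.
  rewrite (cE w) big_seq big1 // => g gF; suff -> : c g w = 0 by rewrite scale0r.
  rewrite /w -!scaleN1r !cD !(additive_scale _ _ (cD g)).
  rewrite (big_morph (c g) (cD g) (additive0 (cD g))) -scale_Posz.
  rewrite (additive_scale _ _ (cD g)) (c1 gF xF).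
  rewrite (eq_bigr (fun j => (m j)%:Z * (g == f j)%:R)) => [|j tj]; last first.
    by rewrite -scale_Posz (additive_scale _ _ (cD g)) c1 // fF.
  have [->|gx] := eqVneq g x.
    rewrite aE big1 => [|j tj]; first by rewrite mulr1n; ring.
    by rewrite eq_sym (negPf (nfx j tj)) mulr0.
  have [cg|cg] := eqVneq (c g (f t)) 0.
    rewrite cg big1 => [|j tj]; first by rewrite mulr0n; ring.
    have [e|_] := eqVneq g (f j); last by rewrite mulr0.
    by rewrite -mE // -e cg mul0r.
  have [|i ti gi] := Fv g gF.
    apply: vS; first exact: supp.
    apply/eqP/negPn/negP => ug; move: gx.
    by rewrite (uniq_x g gF (supp g gF cg) ug) eqxx.
  rewrite (bigD1 i) //= big1 => [|j /andP[tj ji]]; last first.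
    by rewrite gi (inj_eq f_inj) eq_sym (negPf ji) mulr0.
  by rewrite gi eqxx mE //=; ring.
have a0 : (0 < a)%N by rewrite lt0n /a absz_eq0.
have Dx := weyl_base_root ars wF xF.
have m0 (j : 'I_l) : (t < j)%N -> m j = 0%N.
  move=> tj; apply/eqP/negPn/negP => /eqP mj.
  apply: (no_multiple (i := t) (m := m)).
  - exact: leq_ltn_trans tj (ltn_ord j).
  - by exists j.
  - by exists a, x.
have fx : f t = x.
  move: decomp; rewrite big1 ?subr0 => [e|j tj]; last by rewrite m0.
  by rewrite e (root_primitive chark ars (f_Delta t) e).
split; first by rewrite fx.
move=> g gF vg; have [ug|ug] := eqVneq (u jt g) 0.
  by have [i ti ->] := Fv g gF (vS g vg ug); exists i => //; apply: ltnW.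
by exists t => //; rewrite fx; apply: uniq_x.
Qed.

Lemma simple_roots s t : (t + s)%N = l ->
  (forall i : 'I_l, (t <= i)%N -> f i \in F) /\
  {in F, forall g, vanish f (N + t) (to_real R g) ->
     exists2 i : 'I_l, (t <= i)%N & g = f i}.
Proof.
elim: s t => [|s IH] t.
  rewrite addn0 => ->; split.
    by move=> i; rewrite leqNgt ltn_ord.
  move=> g gF /(vanish0_eq0 f_free) g0; exfalso.
  have := basis_neq0 (weyl_base_basis chark ars wF) gF.
  suff -> : g = 0 by rewrite eqxx.
  by apply: (@to_real_inj R); rewrite g0; apply/esym/raddf0.
rewrite addnS -addSn => e; have tl : (t < l)%N by rewrite -e addSn ltnS leq_addr.
have [h1 h2] := IH _ e.
have [ft hv] := @simple_step (Ordinal tl) h1 h2.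
split=> // i; rewrite leq_eqVlt => /orP[/eqP ti|/h1//].
by rewrite (_ : i = Ordinal tl) //; apply: val_inj.
Qed.

Lemma lex_cone v : pcone F v -> to_real R v \in <<real_family R f>>%VS ->
  real_cone R f (to_real R v).
Proof.
move=> pv vspan; have [_ h] := simple_roots (add0n l).
have v0 : vanish f (N + 0) (to_real R v).
  by move=> j; rewrite addn0; apply: coord_span0.
exists (fun i => u (rshift N i) v); split.
  move=> i; apply: (coord_ge0 pv) => g gF cg.
  have [j _ ->] := h g gF (support_vanish pv v0 gF cg).
  by rewrite coord_f // ler0n.
by rewrite {1}(vanish_span f_free v0).
Qed.

End LexBase.

Theorem lemma3 (R : realType) (k : fieldType) (char_k : [pchar k] =i pred0)
    (n : nat) (Delta : set 'cV[int]_n)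
    (chi : 'cV[int]_n -> 'cV[int]_n -> k) (E : {fset 'cV[int]_n})
    (ars : arithmetic_root_system Delta chi E)
    (l : nat) (l_lt_n : (l < n)%N) (f : 'I_l -> 'cV[int]_n)
    (f_Delta : forall i, Delta (f i)) (f_free : free (real_family R f)) :
  [set to_real R v | v in Delta] `&` real_span R f
      `<=` real_cone R f `|` [set - v | v in real_cone R f]
  <->
  (forall (i : 'I_l) (m : 'I_l -> nat), (i.+1 < l)%N ->
     (exists2 j : 'I_l, (i < j)%N & m j <> 0%N) ->
     ~ pos_multiples Delta (f i - \sum_(j < l | (i < j)%N) f j *+ m j)).
Proof.
split.
  move=> incl i m _ [j ij mj] [N [b [N0 Db e]]].
  have NR : (N%:R : R) != 0 by rewrite pnatr_eq0 -lt0n.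
  have NRp : 0 < (N%:R : R) by rewrite ltr0n.
  have eR := congr1 (@to_real R n) e.
  rewrite to_realB to_real_sum to_realMn in eR.
  have fX i' : to_real R (f i') \in <<real_family R f>>%VS.
    by rewrite -real_familyE memv_span // mem_nth ?size_tuple.
  have bX : to_real R b \in <<real_family R f>>%VS.
    rewrite -[to_real R b]scale1r -(mulVf NR) -scalerA -eR memvZ // memvB //.
    by apply: memv_suml => j' _; rewrite to_realMn memvZ.
  have cf i' j' : coord (real_family R f) i' (to_real R (f j')) = (j' == i')%:R.
    by rewrite -real_familyE coord_free.
  have cr (r : 'I_l -> R) i' :
      coord (real_family R f) i' (\sum_(j < l) r j *: to_real R (f j)) = r i'.
    rewrite linear_sum (bigD1 i') //= big1 => [|j' ji].
      by rewrite linearZ_LR /= cf eqxx mulr1 addr0.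
    by rewrite linearZ_LR /= cf (negPf ji) mulr0.
  have cb i' : N%:R * coord (real_family R f) i' (to_real R b) =
      (i == i')%:R - (if (i < i')%N then (m i')%:R else 0).
    rewrite -[LHS](linearZ_LR (coord (real_family R f) i')) -eR linearB /= cf.
    congr (_ - _); rewrite linear_sum big_mkcond (bigD1 i') //= big1 => [|j' ji].
      by case: ifP => _; rewrite addr0 // to_realMn linearZ_LR /= cf eqxx mulr1.
    by case: ifP => // _; rewrite to_realMn linearZ_LR /= cf (negPf ji) mulr0.
  have bi : 0 < coord (real_family R f) i (to_real R b).
    by rewrite -(pmulr_rgt0 _ NRp) cb eqxx ltnn subr0 ltr01.
  have bj : coord (real_family R f) j (to_real R b) < 0.
    rewrite -(pmulr_rlt0 _ NRp) cb ij.
    case: eqVneq => [eij|_]; first by rewrite eij ltnn in ij.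
    by rewrite sub0r oppr_lt0 ltr0n lt0n; apply/eqP.
  have [|[r [r0 rb]]|[w [r [r0 rb]] wb]] := incl (to_real R b).
  - by split=> //; exists b.
  - by move: bj; rewrite rb cr ltNge r0.
  - by move: bi; rewrite -wb linearN /= rb cr oppr_gt0 ltNge r0.
move=> no_mult.
have [b Db|F wF Fpos] :=
    chamber_exists char_k ars (pos := fun g => lexpos f (to_real R g)).
  have bn0 : to_real R b != 0.
    rewrite -(raddf0 (map_mx intr)) (inj_eq (@to_real_inj R n)).
    exact: (root_neq0 char_k ars Db).
  have [h|h] := lexpos_total f_free bn0.
  - by left.
  - by right; rewrite to_realN.
have [c [cD c1 cE]] := basis_coord (weyl_base_basis char_k ars wF).
move=> _ [[b Db <-] bX].
have key := lex_cone char_k ars f_Delta f_free wF Fpos cD c1 cE no_mult.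
case: (root_pcone char_k ars wF Db) => pb; first by left; apply: key.
right; exists (to_real R (- b)); last by rewrite to_realN opprK.
by apply: key => //; rewrite to_realN memvN.
Qed.
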